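(* Let $U=\{x\in\mathbb{R}^3:x_3>0\}$ and let $f\in C_0^{\infty}(B_{\epsilon_1,\epsilon_2}\cap U)$ for some $1<\epsilon_1<\epsilon_2<\infty$. Let $\epsilon_1\le\epsilon\le\epsilon_2$ and let $\delta=\frac{\epsilon^2-1}{2\epsilon}$. Then the apple interior transform $\mathcal{AI}f(r,\alpha,\beta)$ known for $0\le r\le\delta$ and for all $(\alpha,\beta)\in S^2$ determines $f$ uniquely for $1\le|x|\le\epsilon$. That is, if $f_1,f_2\in C_0^{\infty}(B_{\epsilon_1,\epsilon_2}\cap U)$ satisfy $\mathcal{AI}f_1(r,\alpha,\beta)=\mathcal{AI}f_2(r,\alpha,\beta)$ for all $0\le r\le\delta$ and $(\alpha,\beta)\in S^2$, then $f_1(x)=f_2(x)$ for all $1\le|x|\le\epsilon$.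
   Context: Hollow balls: $B_{a,b}=\{x\in\mathbb{R}^3: a<|x|<b\}$. $C_0^\infty(\Omega)$ denotes smooth real-valued functions with compact support in $\Omega$, extended by zero to $\mathbb{R}^3$. Polar form: $F(\rho,\theta,\varphi)=f(\rho\sin\varphi\cos\theta,\rho\sin\varphi\sin\theta,\rho\cos\varphi)$, with $\theta\in[0,2\pi]$ the azimuth and $\varphi\in[0,\pi]$ the colatitude. Rotations: $h=U(\alpha)V(\beta)\in \mathrm{SO}(3)$, where $U(\alpha)$ and $V(\beta)$ (matrices, not to be confused with the half space $U$) are the rotations about the $x_3$- and $x_2$-axis by angles $\alpha\in[0,2\pi]$, $\beta\in[0,\pi]$ respectively, so that $h(0,0,1)^T=(\sin\beta\cos\alpha,\sin\beta\sin\alpha,\cos\beta)^T$. The pair $(\alpha,\beta)$ is identified with this point of $S^2$. The action is $(h\cdot f)(x)=f(hx)$, and $h\cdot F$ is the polar form of $h\cdot f$. Apple interior transform: for $r\ge0$ and $(\alpha,\beta)\in S^2$, $$\mathcal{AI}f(r,\alpha,\beta)=\int_{0}^{2\pi}\int_{0}^{\pi}\int_{1}^{\sqrt{r^2\sin^2\varphi+1}+r\sin\varphi}\rho^2\sin\varphi\,(h\cdot F)(\rho,\theta,\varphi)\,\mathrm{d}\rho\,\mathrm{d}\varphi\,\mathrm{d}\theta,\qquad h=U(\alpha)V(\beta).$$ *)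

(* Defs.v *)
From HB Require Import structures.
From mathcomp Require Import all_boot all_order all_algebra.
From mathcomp Require Import all_classical all_reals all_analysis.

Set Implicit Arguments.
Unset Strict Implicit.
Unset Printing Implicit Defensive.

Import Order.TTheory GRing.Theory Num.Theory.
Import numFieldNormedType.Exports.

Local Open Scope classical_set_scope.
Local Open Scope ring_scope.

(* Points of R^3 are column vectors; the coordinates x_1, x_2, x_3 are
   x 0 0, x 1 0, x 2 0. *)
Definition vec3 (R : realType) (a b c : R) : 'cV[R]_3 :=
  \col_(i < 3) [:: a; b; c]`_i.

Definition mx3 (R : realType) (rows : seq (seq R)) : 'M[R]_3 :=
  \matrix_(i < 3, j < 3) (nth [::] rows i)`_j.

(* The library norm `|x| on 'cV[R]_3 is the sup norm, so the Euclidean one has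
   to be introduced.  The two induce the same topology. *)
Definition enorm (R : realType) (x : 'cV[R]_3) : R :=
  Num.sqrt (\sum_(i < 3) x i 0 ^+ 2).

Definition hollow_ball (R : realType) (a b : R) : set 'cV[R]_3 :=
  [set x | a < enorm x < b].

Definition upper_half_space (R : realType) : set 'cV[R]_3 :=
  [set x | 0 < x 2 0].
Arguments upper_half_space : clear implicits.

(* C^k on R^3 by recursion on k: continuous, with first-order partial
   derivatives existing everywhere and of class C^(k-1). *)
Fixpoint classC (R : realType) (k : nat) (f : 'cV[R]_3 -> R) : Prop :=
  continuous f /\
  match k with
  | 0%N => True
  | k'.+1 => forall i : 'I_3,
      (forall x, derivable f x (delta_mx i 0)) /\
      classC k' ('D_(delta_mx i 0) f)
  end.

Definition smooth (R : realType) (f : 'cV[R]_3 -> R) : Prop :=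
  forall k : nat, classC k f.

Definition support (R : realType) (f : 'cV[R]_3 -> R) : set 'cV[R]_3 :=
  closure [set x | f x != 0].

(* Its elements are already extended by zero to R^3. *)
Definition C0infty (R : realType) (Omega : set 'cV[R]_3) :
    set ('cV[R]_3 -> R) :=
  [set f | [/\ smooth f, compact (support f) & support f `<=` Omega]].

Definition rotU (R : realType) (alpha : R) : 'M[R]_3 :=
  mx3 [:: [:: cos alpha; - sin alpha; 0];
          [:: sin alpha;   cos alpha; 0];
          [:: 0;           0;         1]].

Definition rotV (R : realType) (beta : R) : 'M[R]_3 :=
  mx3 [:: [:: cos beta;    0; sin beta];
          [:: 0;           1; 0];
          [:: - sin beta;  0; cos beta]].

Definition rot_act (R : realType) (h : 'M[R]_3) (f : 'cV[R]_3 -> R) :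
    'cV[R]_3 -> R :=
  fun x => f (h *m x).

Definition polar_form (R : realType) (f : 'cV[R]_3 -> R) (rho theta phi : R) :
    R :=
  f (vec3 (rho * sin phi * cos theta) (rho * sin phi * sin theta)
          (rho * cos phi)).

(* The upper radial limit is at least 1 for 0 <= r and 0 <= phi <= pi, so the
   integral over the interval is the oriented one. *)
Definition apple_interior (R : realType) (f : 'cV[R]_3 -> R)
    (r alpha beta : R) : R :=
  let h := rotU alpha *m rotV beta in
  \int[@lebesgue_measure R]_(theta in `[0, 2 * pi])
    \int[@lebesgue_measure R]_(phi in `[0, pi])
      \int[@lebesgue_measure R]_(rho in
          `[1, Num.sqrt (r ^+ 2 * sin phi ^+ 2 + 1) + r * sin phi])
        (rho ^+ 2 * sin phi * polar_form (rot_act h f) rho theta phi).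

Lemma rot_e3 (R : realType) (alpha beta : R) :
  (rotU alpha *m rotV beta) *m vec3 0 0 1 =
  vec3 (sin beta * cos alpha) (sin beta * sin alpha) (cos beta).
Proof.
apply/matrixP => i j; rewrite -mulmxA !mxE !big_ord_recl !big_ord0.
rewrite !mxE !big_ord_recl !big_ord0 !mxE /=.
rewrite !(mulr0, mulr1, mul0r, mul1r, addr0, add0r).
case: i => -[|[|[|//]]] lti /=;
  by rewrite !(mulr0, mulr1, mul0r, mul1r, addr0, add0r) // mulrC.
Qed.

(* Main.v *)
Require Import Defs.
From mathcomp Require Import all_boot all_order all_algebra.
From mathcomp Require Import all_classical all_reals all_analysis.
From mathcomp Require Import ring lra.
Import Order.TTheory GRing.Theory Num.Theory.
Import numFieldNormedType.Exports.

(** Let [f] be the difference of the two functions.  The apple interior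
    transform integrates [f] over the region [t <= r sin phi], where
    [t = (rho - rho^-1) / 2] increases with the distance [rho] to the origin and
    [phi] is the angle to the axis of the frame.  Its derivative in [r] is an
    integral over the apple surface [t = r sin phi], so these surface integrals
    vanish for all [r] below delta and, by Euler angles, for all frames.

    The functions with this property form a class that is closed under the
    derivatives [x |-> grad f x . (a cross x)] along rotations ([null_rot_deriv]):
    it suffices to turn the frame.  At constant [t], the derivative along a
    rotation about a horizontal axis of the frame is a first-order operator in
    the azimuth [theta] and in [phi].  Inserting it into the surface integrals
    and integrating by parts yields equations [r P' = k P] for the moments [P]
    of [f] against [cot phi ^+ n cos theta], [cot phi ^+ n sin theta] for odd [n]
    and [cot phi ^+ n] for even [n], provided that the preceding ones vanish
    ([odd_step], [even_step]).  As [f] is zero near the unit ball, every moment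
    is zero for small [r], hence for all [r < delta].  Since [cot phi ^+ 2]
    separates the equator from all other latitudes, the mean of [f] over the
    equator is zero: the integrals of [f] over all great circles of radius
    between 1 and [eps] vanish ([great_circle_mean_zero]).

    In general this determines only the even part of [f].  Here the lower half
    of each circle contributes nothing, and the same device of rotational
    derivatives localises on the upper half.  When a circle is tilted about a
    horizontal line, its points [x] at angle [theta] from that line move so that
    [cot theta] times the tilt derivative of [f] is a rotational derivative of
    [f].  Thus the tilt derivative of the moment of order [n.+1] in [cot theta]
    is a moment of order [n] of another function of the class, and all moments
    vanish as they do for the horizontal circle.  They determine [f] on the
    upper half circle ([circ_zero]).

    Throughout, rotations act on [f], and the identities come from
    differentiating integrals with respect to a parameter. *)

Set Implicit Arguments.
Unset Strict Implicit.
Unset Printing Implicit Defensive.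

Local Open Scope classical_set_scope.
Local Open Scope ring_scope.

(** * Continuity and derivatives of explicit functions *)

Section continuity_at.
Context {R : realType} {T : topologicalType}.
Implicit Types (t : T) (f g : T -> R).

Lemma cont_cst t (k : R) : {for t, continuous (fun=> k : R)}.
Proof. exact: cvg_cst. Qed.

Lemma contD t f g : {for t, continuous f} -> {for t, continuous g} ->
  {for t, continuous (fun x => f x + g x : R)}.
Proof. exact: cvgD. Qed.

Lemma contN t f : {for t, continuous f} -> {for t, continuous (fun x => - f x : R)}.
Proof. exact: cvgN. Qed.

Lemma contB t f g : {for t, continuous f} -> {for t, continuous g} ->
  {for t, continuous (fun x => f x - g x : R)}.
Proof. exact: cvgB. Qed.

Lemma contM t f g : {for t, continuous f} -> {for t, continuous g} ->
  {for t, continuous (fun x => f x * g x : R)}.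
Proof. exact: cvgM. Qed.

Lemma contX t f n : {for t, continuous f} ->
  {for t, continuous (fun x => f x ^+ n : R)}.
Proof.
move=> cf; elim: n => [|n IHn]; first exact: cont_cst.
rewrite (_ : (fun x => _) = fun x => f x * f x ^+ n); last first.
  by apply/funext => x; rewrite exprS.
exact: contM.
Qed.

Lemma contV t f : f t != 0 -> {for t, continuous f} ->
  {for t, continuous (fun x => (f x)^-1 : R)}.
Proof. by move=> ft0 cf; apply: cvgV. Qed.

End continuity_at.

Lemma cont_comp {T U V : topologicalType} (t : T) (f : T -> U) (h : U -> V) :
  {for t, continuous f} -> {for f t, continuous h} ->
  {for t, continuous (fun x => h (f x))}.
Proof. by move=> cf ch; exact: (continuous_comp cf ch). Qed.

Lemma cont_pair {T U V : topologicalType} (t : T) (f : T -> U) (g : T -> V) :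
  {for t, continuous f} -> {for t, continuous g} ->
  {for t, continuous (fun x => (f x, g x))}.
Proof. by move=> cf cg; apply: cvg_pair. Qed.

Lemma cont_id {T : topologicalType} (t : T) : {for t, continuous id}.
Proof. exact: cvg_id. Qed.

Lemma cont_fst {T U : topologicalType} (p : T * U) : {for p, continuous fst}.
Proof. exact: cvg_fst. Qed.

Lemma cont_snd {T U : topologicalType} (p : T * U) : {for p, continuous snd}.
Proof. exact: cvg_snd. Qed.

(** Continuity and differentiability of explicit functions by structural
    descent.  The cases are selected by the head symbol of the body, so that no
    higher-order unification is attempted against the inferred structures. *)
Ltac cont_step :=
  lazy beta delta [prop_for];
  lazymatch goal with
  | |- continuous_at ?t (fun _ => ?k) => exact (@cont_cst _ _ t k)
  | |- continuous_at ?t (fun y => y) => exact (@cont_id _ t)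
  | |- continuous_at ?t (fun y => GRing.add (@?f y) (GRing.opp (@?g y))) =>
      refine (@contB _ _ t f g _ _)
  | |- continuous_at ?t (fun y => GRing.add (@?f y) (@?g y)) =>
      refine (@contD _ _ t f g _ _)
  | |- continuous_at ?t (fun y => GRing.opp (@?f y)) =>
      refine (@contN _ _ t f _)
  | |- continuous_at ?t (fun y => GRing.mul (@?f y) (@?g y)) =>
      refine (@contM _ _ t f g _ _)
  | |- continuous_at ?t (fun y => GRing.exp (@?f y) ?n) =>
      refine (@contX _ _ t f n _)
  | |- continuous_at ?t (fun y => GRing.inv (@?f y)) =>
      refine (@contV _ _ t f _ _)
  | |- continuous_at ?t (fun y => Num.norm (@?f y)) =>
      refine (@cont_comp _ _ _ t f (fun x => Num.norm x) _ (@norm_continuous _ _ _))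
  | |- continuous_at ?t (fun y => sin (@?f y)) =>
      refine (@cont_comp _ _ _ t f sin _ (@continuous_sin _ _))
  | |- continuous_at ?t (fun y => cos (@?f y)) =>
      refine (@cont_comp _ _ _ t f cos _ (@continuous_cos _ _))
  | |- continuous_at ?t (fun y => Num.sqrt (@?f y)) =>
      refine (@cont_comp _ _ _ t f Num.sqrt _ (@sqrt_continuous _ _))
  | |- continuous_at ?t (fun y => pair (@?f y) (@?g y)) =>
      refine (@cont_pair _ _ _ t f g _ _)
  | |- continuous_at ?t (fun y => fst (@?f y)) =>
      refine (@cont_comp _ _ _ t f fst _ (@cont_fst _ _ _))
  | |- continuous_at ?t (fun y => snd (@?f y)) =>
      refine (@cont_comp _ _ _ t f snd _ (@cont_snd _ _ _))
  end.
Ltac cont := repeat cont_step; lazy beta.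

Section derivative_rules.
Context {R : realType}.
Implicit Types (f g h : R -> R) (s df dg : R).

Lemma der_cst s (k : R) : is_derive s (1 : R) (fun=> k : R) 0.
Proof. exact: is_derive_cst. Qed.

Lemma der_id s : is_derive s (1 : R) (fun x : R => x) 1.
Proof. exact: is_derive_id. Qed.

Lemma derD s f g df dg :
  is_derive s (1 : R) f df -> is_derive s (1 : R) g dg ->
  is_derive s (1 : R) (fun x => f x + g x : R) (df + dg).
Proof. by move=> Df Dg; exact: is_deriveD. Qed.

Lemma derN s f df :
  is_derive s (1 : R) f df -> is_derive s (1 : R) (fun x => - f x : R) (- df).
Proof. by move=> Df; exact: is_deriveN. Qed.

Lemma derM s f g df dg :
  is_derive s (1 : R) f df -> is_derive s (1 : R) g dg ->
  is_derive s (1 : R) (fun x => f x * g x : R) (f s * dg + g s * df).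
Proof. by move=> Df Dg; exact: is_deriveM. Qed.

Lemma derX s f df n : is_derive s (1 : R) f df ->
  is_derive s (1 : R) (fun x => f x ^+ n : R) (n%:R * f s ^+ n.-1 * df).
Proof.
move=> Df; rewrite (_ : (fun x => _) = f ^+ n); first exact: is_deriveX.
by apply/funext => x; rewrite exprfctE.
Qed.

Lemma derV s f df : f s != 0 -> is_derive s (1 : R) f df ->
  is_derive s (1 : R) (fun x => (f x)^-1 : R) (- (f s) ^- 2 * df).
Proof. by move=> f0 Df; exact: is_deriveV. Qed.

Lemma der_comp s h f dh df :
  is_derive (f s) (1 : R) h dh -> is_derive s (1 : R) f df ->
  is_derive s (1 : R) (fun x => h (f x)) (dh * df).
Proof. by move=> Dh Df; exact: is_derive1_comp. Qed.

Lemma der_eq s f (d d' : R) :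
  is_derive s (1 : R) f d -> d = d' -> is_derive s (1 : R) f d'.
Proof. by move=> Df <-. Qed.

Lemma der_continuous s f df :
  is_derive s (1 : R) f df -> {for s, continuous f}.
Proof.
by case=> Df _; apply/differentiable_continuous/derivable1_diffP.
Qed.

End derivative_rules.

Ltac der_step :=
  lazymatch goal with
  | |- is_derive ?s _ (fun _ => ?k) _ => exact (@der_cst _ s k)
  | |- is_derive ?s _ (fun y => y) _ => exact (@der_id _ s)
  | |- is_derive ?s _ (fun y => GRing.add (@?f y) (@?g y)) _ =>
      notypeclasses refine (@derD _ s f g _ _ _ _)
  | |- is_derive ?s _ (fun y => GRing.opp (@?f y)) _ =>
      notypeclasses refine (@derN _ s f _ _)
  | |- is_derive ?s _ (fun y => GRing.mul (@?f y) (@?g y)) _ =>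
      notypeclasses refine (@derM _ s f g _ _ _ _)
  | |- is_derive ?s _ (fun y => GRing.exp (@?f y) ?n) _ =>
      notypeclasses refine (@derX _ s f _ n _)
  | |- is_derive ?s _ (fun y => GRing.inv (@?f y)) _ =>
      notypeclasses refine (@derV _ s f _ _ _)
  | |- is_derive ?s _ (fun y => sin (@?f y)) _ =>
      notypeclasses refine (@der_comp _ s sin f _ _ (is_derive_sin _) _)
  | |- is_derive ?s _ (fun y => cos (@?f y)) _ =>
      notypeclasses refine (@der_comp _ s cos f _ _ (is_derive_cos _) _)
  | |- is_derive ?s _ (fun y => expR (@?f y)) _ =>
      notypeclasses refine (@der_comp _ s expR f _ _ (is_derive_expR _) _)
  end; cbv beta.
Ltac der := notypeclasses refine (der_eq _ _); [repeat der_step|].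

(** * Integrals over segments *)

Section segment_integral.
Context {R : realType}.
Implicit Types (a b c x y : R) (f g F : R -> R).

Definition sint a b f : R := \int[@lebesgue_measure R]_(x in `[a, b]) f x.

Lemma in_continuous_within a b f :
  {in `[a, b], continuous f} -> {within `[a, b], continuous f}.
Proof.
move=> cf; apply: continuous_in_subspaceT => x; rewrite inE /= => xab.
exact: cf.
Qed.

Lemma sint_integrable a b f : {in `[a, b], continuous f} ->
  (@lebesgue_measure R).-integrable `[a, b] (EFin \o f).
Proof.
move=> cf; apply: continuous_compact_integrable; first exact: segment_compact.
exact: in_continuous_within.
Qed.

Lemma eq_sint a b f g : (forall x, a <= x <= b -> f x = g x) ->
  sint a b f = sint a b g.
Proof.
by move=> fg; apply: eq_Rintegral => x; rewrite inE /= in_itv /= => /fg.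
Qed.

Lemma sint0 a b : sint a b (fun=> 0) = 0.
Proof. by rewrite /sint Rintegral_cst //= mul0r. Qed.

Lemma sintD a b f g : {in `[a, b], continuous f} -> {in `[a, b], continuous g} ->
  sint a b (fun x => f x + g x) = sint a b f + sint a b g.
Proof. by move=> cf cg; apply: RintegralD => //; exact: sint_integrable. Qed.

Lemma sintB a b f g : {in `[a, b], continuous f} -> {in `[a, b], continuous g} ->
  sint a b (fun x => f x - g x) = sint a b f - sint a b g.
Proof. by move=> cf cg; apply: RintegralB => //; exact: sint_integrable. Qed.

Lemma sintZ a b k f : {in `[a, b], continuous f} ->
  sint a b (fun x => k * f x) = k * sint a b f.
Proof. by move=> cf; apply: RintegralZl => //; exact: sint_integrable. Qed.

Lemma sint_cst a b k : a <= b -> sint a b (fun=> k) = k * (b - a).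
Proof.
move=> ab; rewrite /sint Rintegral_cst //= lebesgue_measure_itv /= lte_fin.
by move: ab; rewrite le_eqVlt => /predU1P[->|->] //; rewrite ltxx subrr.
Qed.

Lemma le_sint a b f g :
  {in `[a, b], continuous f} -> {in `[a, b], continuous g} ->
  (forall x, a <= x <= b -> f x <= g x) -> sint a b f <= sint a b g.
Proof.
by move=> cf cg fg; apply: le_Rintegral => //; exact: sint_integrable.
Qed.

Lemma norm_sint_le a b f k : a <= b -> {in `[a, b], continuous f} ->
  (forall x, a <= x <= b -> `|f x| <= k) -> `|sint a b f| <= k * (b - a).
Proof.
move=> ab cf fk; rewrite -(sint_cst k ab) ler_norml; apply/andP; split.
  rewrite lerNl -mulN1r -sintZ //; apply: le_sint.
  - by move=> x /cf; apply: contM; exact: cont_cst.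
  - by move=> x _; exact: cont_cst.
  - by move=> x /fk; rewrite mulN1r ler_norml lerNl => /andP[].
apply: le_sint => //; first by move=> x _; exact: cont_cst.
by move=> x /fk; rewrite ler_norml => /andP[].
Qed.

Lemma sint_FTC2 a b F f : a < b ->
  (forall x, a <= x <= b -> is_derive x 1 F (f x)) ->
  {in `[a, b], continuous f} -> sint a b f = F b - F a.
Proof.
move=> ab dF cf; rewrite /sint /Rintegral.
have cF x : a <= x <= b -> {for x, continuous F}.
  move=> /dF [dFx _]; apply: differentiable_continuous.
  exact/derivable1_diffP.
rewrite (continuous_FTC2 (F := F)) //.
- exact: in_continuous_within.
- split.
  + by move=> x /subset_itv_oo_cc; rewrite in_itv /= => /dF [].
  + by apply: cvg_at_right_filter; apply: cF; rewrite lexx ltW.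
  + by apply: cvg_at_left_filter; apply: cF; rewrite lexx ltW.
- move=> x /subset_itv_oo_cc; rewrite in_itv /= => /dF [_].
  by rewrite derive1E.
Qed.

(** Lets the poles be cut off: near them the integrands below vanish, while
    the weights [cot ^+ n] are singular. *)
Lemma sint_restrict a b c d f : c <= a -> b <= d ->
  (forall x, c <= x <= d -> ~~ (a <= x <= b) -> f x = 0) ->
  sint c d f = sint a b f.
Proof.
move=> ca bd f0; rewrite /sint [LHS]Rintegral_mkcond [RHS]Rintegral_mkcond.
congr Rintegral; apply/funext => x; rewrite !patchE.
have memE u v : (x \in `[u, v]%classic) = (u <= x <= v).
  by rewrite mem_setE in_itv.
rewrite !memE; have [xab|xab] := boolP (a <= x <= b); last first.
  by case: ifP => // xcd; exact: f0.
case/andP: xab => ax xb.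
by rewrite (le_trans ca ax) (le_trans xb bd).
Qed.

End segment_integral.

(** * Integrals depending on a parameter *)

Section parametric_integral.
Context {R : realType}.
Implicit Types (a b r x y e : R).

(** Continuity is required at every point of the strip over the segment, with
    full neighbourhoods, so that integrands may be singular elsewhere. *)
Definition jcont {T : topologicalType} (a b : R) (K : T -> R -> R) :=
  forall (p : T) (x : R), a <= x <= b -> {for (p, x), continuous (fun q => K q.1 q.2 : R)}.

Lemma jcont_slice {T : topologicalType} a b (K : T -> R -> R) p :
  jcont a b K -> {in `[a, b], continuous (K p)}.
Proof.
move=> cK x; rewrite in_itv /= => /(cK p) cKpx.
have cp : {for x, continuous (fun y : R => (p, y))}.
  by apply: cont_pair; [exact: cvg_cst | exact: cvg_id].
exact: (cont_comp cp cKpx).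
Qed.

(** Uniformity over the segment comes from its compactness, in the form of the
    tube lemma. *)
Lemma jcont_near {T : topologicalType} a b (K : T -> R -> R) p e :
  jcont a b K -> 0 < e ->
  \forall q \near p, forall x, a <= x <= b -> `|K q x - K p x| < e.
Proof.
move=> cK e0.
have := @segment_compact R a b; rewrite compact_near_coveringP => cov.
have : \forall q \near p, `[a, b]%classic `<=` (fun x => `|K q x - K p x| < e).
  apply: cov => x /=; rewrite in_itv /= => xab.
  have e20 : 0 < e / 2 by rewrite divr_gt0.
  have := cK p x xab; move=> /cvgrPdist_lt /(_ _ e20) nK.
  have := @jcont_slice _ a b K p cK x; rewrite in_itv /= => /(_ xab).
  move=> /cvgrPdist_lt /(_ _ e20) nKp.
  case: nK => -[A B] /= [pA xB] AB.
  exists (B `&` (fun y => `|K p x - K p y| < e / 2), A) => /=.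
    by split => //; exact: filterI.
  move=> -[x' q] /= [[Bx' Kx'] Aq].
  rewrite (splitr e) -(subrKA (K p x)) (le_lt_trans (ler_normD _ _)) // ltrD //.
  by rewrite distrC; exact: (AB (q, x')).
apply: filterS => q Kq x xab; apply: Kq.
by rewrite /= in_itv.
Qed.

Lemma sint_param_continuous {T : topologicalType} a b (K : T -> R -> R) :
  a <= b -> jcont a b K -> continuous (fun p => sint a b (K p)).
Proof.
move=> ab cK p; apply/cvgrPdist_le => e e0.
have ba1 : 0 < b - a + 1 by rewrite ltr_wpDl // subr_ge0.
have := @jcont_near _ a b K p _ cK (divr_gt0 e0 ba1).
apply: filterS => q Kq.
rewrite -sintB; [|exact: (jcont_slice cK)|exact: (jcont_slice cK)].
rewrite (@le_trans _ _ (e / (b - a + 1) * (b - a))) //.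
  apply: norm_sint_le => // x xab.
    by apply: contB; exact: (jcont_slice cK).
  by rewrite distrC ltW // Kq.
by rewrite -mulrA ger_pMr // mulrC ler_pdivrMr // mul1r lerDl.
Qed.

(** The bound needed for domination is the derivative at the base point plus
    one, by uniformity over the segment. *)
Lemma sint_param_derive a b (K K' : R -> R -> R) r :
  (forall r, {in `[a, b], continuous (K r)}) -> jcont a b K' ->
  (forall r x, a <= x <= b -> is_derive r (1 : R) (K^~ x) (K' r x)) ->
  is_derive r (1 : R) (fun r => sint a b (K r)) (sint a b (K' r)).
Proof.
move=> cK cK' dK.
have K'E (s x : R) : a <= x <= b -> partial1of2 K s x = K' s x.
  by move=> /(dK s) [_]; rewrite partial1of2E.
have := @jcont_near _ a b K' r _ cK' (@ltr01 R); move=> /nbhs_ballP [d /= d0 dK1].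
pose G (x : R) := `|K' r x| + 1.
have rI : `]r - d, r + d[%classic r.
  by rewrite /= in_itv /= ltrDl gtrBl d0.
have intK (x : R) : `]r - d, r + d[%classic x ->
    (@lebesgue_measure R).-integrable `[a, b] (EFin \o K x).
  by move=> _; exact: sint_integrable.
have derK (x y : R) : `]r - d, r + d[%classic x -> `[a, b]%classic y ->
    derivable (K ^~ y) x 1.
  by rewrite /= !in_itv /= => _ /(dK x) [].
have G0 (y : R) : 0 <= G y by rewrite addr_ge0.
have intG : (@lebesgue_measure R).-integrable `[a, b] (EFin \o G).
  apply: sint_integrable => x xab.
  have cN : {for x, continuous (fun y => `|K' r y| : R)}.
    apply: (cont_comp (jcont_slice cK' (p := r) xab)).
    exact: norm_continuous.
  have cG := contD cN (@cont_cst R R x 1); exact cG.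
have Gub (x y : R) : `]r - d, r + d[%classic x -> `[a, b]%classic y ->
    `|partial1of2 K x y| <= G y.
  rewrite /= !in_itv /= => xrd yab; rewrite K'E // /G -lerBlDl.
  rewrite (le_trans (lerB_dist _ _)) // ltW // dK1 //.
  by rewrite /ball /= ltr_distlC.
have mab := @measurable_itv R `[a, b].
have dI := @derivable_under_integral R _ _ (@lebesgue_measure R) K _ mab
  _ _ _ rI intK derK G G0 intG Gub.
have dE := @differentiation_under_integral R _ _ (@lebesgue_measure R) K _ mab
  _ _ _ rI intK derK G G0 intG Gub.
apply: DeriveDef => //; rewrite -derive1E dE.
by apply: eq_sint => x xab; exact: K'E.
Qed.

End parametric_integral.

(** * Iterated integrals *)

Section double_integral.
Context {R : realType}.
Implicit Types (a b c d k : R) (F G : R -> R -> R).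

Definition dint c d a b F : R := sint c d (fun x => sint a b (F x)).

Lemma eq_dint c d a b F G :
  (forall x y, c <= x <= d -> a <= y <= b -> F x y = G x y) ->
  dint c d a b F = dint c d a b G.
Proof. by move=> FG; apply: eq_sint => x xcd; apply: eq_sint => y; exact: FG. Qed.

Lemma jcontD {T : topologicalType} a b (K L : T -> R -> R) :
  jcont a b K -> jcont a b L -> jcont a b (fun x y => K x y + L x y).
Proof. by move=> cK cL x y yab; apply: contD; [exact: cK|exact: cL]. Qed.

Lemma jcontM {T : topologicalType} a b (K L : T -> R -> R) :
  jcont a b K -> jcont a b L -> jcont a b (fun x y => K x y * L x y).
Proof. by move=> cK cL x y yab; apply: contM; [exact: cK|exact: cL]. Qed.

Lemma jcont_cst {T : topologicalType} a b k : jcont a b (fun (_ : T) _ => k).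
Proof. by move=> x y yab; exact: cont_cst. Qed.

Lemma jcont_snd {T : topologicalType} a b (u : R -> R) :
  {in `[a, b], continuous u} -> jcont a b (fun (_ : T) y => u y).
Proof.
move=> cu x y yab.
have cuy : {for (x, y).2, continuous u} by apply: cu; rewrite in_itv.
exact: (cont_comp (@cont_snd T R (x, y)) cuy).
Qed.

Lemma jcont_sint c d a b F : a <= b -> jcont a b F ->
  {in `[c, d], continuous (fun x => sint a b (F x) : R)}.
Proof. by move=> ab cF x _; exact: sint_param_continuous. Qed.

Lemma dintD c d a b F G : a <= b -> jcont a b F -> jcont a b G ->
  dint c d a b (fun x y => F x y + G x y) = dint c d a b F + dint c d a b G.
Proof.
move=> ab cF cG; rewrite /dint -sintD; [|exact: jcont_sint..].
by apply: eq_sint => x _; rewrite sintD //; exact: jcont_slice.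
Qed.

Lemma dintZ c d a b k F : a <= b -> jcont a b F ->
  dint c d a b (fun x y => k * F x y) = k * dint c d a b F.
Proof.
move=> ab cF; rewrite /dint -sintZ; last exact: jcont_sint.
by apply: eq_sint => x _; rewrite sintZ //; exact: jcont_slice.
Qed.

Lemma dint0 c d a b : dint c d a b (fun _ _ => 0) = 0.
Proof.
by rewrite /dint -[RHS](sint0 c d); apply: eq_sint => x _; rewrite sint0.
Qed.

Lemma dint_param_derive c d a b (K K' : R -> R -> R -> R) (r : R) :
  a <= b -> c <= d ->
  jcont a b (fun (q : R * R) => K q.1 q.2) ->
  jcont a b (fun (q : R * R) => K' q.1 q.2) ->
  (forall r x y, a <= y <= b ->
    is_derive r (1 : R) (fun r => K r x y) (K' r x y)) ->
  is_derive r (1 : R) (fun r => dint c d a b (K r)) (dint c d a b (K' r)).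
Proof.
move=> ab cd cK cK' dK.
have slice (L : R -> R -> R -> R) s :
    jcont a b (fun (q : R * R) => L q.1 q.2) -> jcont a b (L s).
  move=> cL x y yab.
  have cp : {for (x, y), continuous (fun p : R * R => (s, p.1, p.2))}.
    apply: cont_pair; last exact: cont_snd.
    by apply: cont_pair; [exact: cvg_cst|exact: cont_fst].
  exact: (cont_comp cp (cL (s, x) y yab)).
have slice2 (L : R -> R -> R -> R) x :
    jcont a b (fun (q : R * R) => L q.1 q.2) -> jcont a b (fun s => L s x).
  move=> cL s y yab.
  have cp : {for (s, y), continuous (fun p : R * R => (p.1, x, p.2))}.
    apply: cont_pair; last exact: cont_snd.
    by apply: cont_pair; [exact: cont_fst|exact: cvg_cst].
  exact: (cont_comp cp (cL (s, x) y yab)).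
apply: (@sint_param_derive _ c d (fun s x => sint a b (K s x))
         (fun s x => sint a b (K' s x)) r).
- by move=> s; apply: jcont_sint => //; exact: slice.
- move=> s x _.
  have /= := @sint_param_continuous _ _ a b _ ab cK'; exact.
- move=> s x _.
  apply: (@sint_param_derive _ a b (fun s y => K s x y)
    (fun s y => K' s x y) s).
  + by move=> t; apply: jcont_slice; exact: slice.
  + exact: slice2.
Qed.

End double_integral.

(** * Vanishing moments *)

Section moments.
Context {R : realType}.
Implicit Types (a b c d x y : R).

Lemma sint_subset_le a b c d (f : R -> R) : c <= a -> b <= d ->
  {in `[c, d], continuous f} -> (forall x, c <= x <= d -> 0 <= f x) ->
  sint a b f <= sint c d f.
Proof.
move=> ca bd cf f0; have cabd : `[a, b] `<=` `[c, d].
  move=> x /=; rewrite !in_itv /= => /andP[ax xb].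
  by rewrite (le_trans ca ax) (le_trans xb bd).
have intf := sint_integrable cf.
have intf' : (@lebesgue_measure R).-integrable `[a, b] (EFin \o f).
  by apply: integrableS intf.
apply: fine_le; [exact: integrable_fin_num..|].
apply: ge0_subset_integral => //.
by case/integrableP : intf.
Qed.

(** On the far set, which is compact, [p] stays below some [q < 1], while near
    [x0] it exceeds [(1 + q) / 2]: the ratio of the powers tends to zero, so the
    normalised powers of [p] form an approximate identity at [x0]. *)
Lemma peak_concentration a b (x0 : R) (p : R -> R) (e h : R) :
  a < x0 < b -> 0 < e -> 0 < h ->
  {in `[a, b], continuous p} ->
  (forall x, a <= x <= b -> 0 <= p x) -> p x0 = 1 ->
  (forall x, a <= x <= b -> x != x0 -> p x < 1) ->
  exists n, 0 < sint a b (fun x => p x ^+ n) /\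
    forall x, a <= x <= b -> e <= `|x - x0| ->
      p x ^+ n <= h * sint a b (fun x => p x ^+ n).
Proof.
move=> /andP[ax0 x0b] e0 h0 cp p0 px0 p1.
have [q [q0 q1 pq]] : exists q, [/\ 0 <= q, q < 1 &
    forall x, a <= x <= b -> e <= `|x - x0| -> p x <= q].
  pose far := `[a, b]%classic `&` [set x | e <= `|x - x0|].
  have [[z farz]|far0] := pselect (far !=set0); last first.
    exists 0; split => // x xab xe; exfalso; apply: far0; exists x.
    by split => //=; rewrite in_itv.
  have cfar : compact far.
    apply: (@subclosed_compact _ _ `[a, b]%classic) => //.
    - apply: closedI; first exact: itv_closed.
      rewrite (_ : [set x | _] = (fun x => `|x - x0|) @^-1` [set y | e <= y])//.
      apply: closed_comp; last exact: closed_ge.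
      move=> x _; apply: (@cont_comp _ _ _ x (fun x => x - x0) (@Num.norm _ R)).
        by cont_step; [exact: cont_id|exact: cont_cst].
      exact: norm_continuous.
    - exact: segment_compact.
    - by move=> x [].
  have cpfar : {within far, continuous p}.
    apply: continuous_in_subspaceT => x; rewrite inE => -[xab _].
    exact: cp.
  have [w [+ wmax]] := @compact_EVT_max _ R p far (ex_intro _ z farz) cfar cpfar.
  rewrite inE => -[/= wab we].
  rewrite in_itv /= in wab.
  exists (p w); split; first exact: p0.
    apply: p1 => //; apply: contraTneq we => ->.
    by rewrite subrr normr0 -ltNge.
  by move=> x xab xe; apply: wmax; rewrite inE.
(* Midway between the far bound and the maximum. *)
pose q' := (1 + q) / 2.
have qq' : q < q' by rewrite /q'; lra.
have q'0 : 0 < q' by lra.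
have q'1 : q' < 1 by rewrite /q'; lra.
have cpx0 : {for x0, continuous p} by apply: cp; rewrite in_itv /= !ltW.
have : \forall x \near x0, q' < p x.
  by apply: (cvgr_gt _ cpx0); rewrite px0.
move=> /nbhs_ballP[r /= r0 rp].
pose d := Num.min (r / 2) (Num.min (x0 - a) (b - x0)).
have d0 : 0 < d.
  by rewrite !lt_min !subr_gt0 ax0 x0b divr_gt0.
have dr : d < r by rewrite (@le_lt_trans _ _ (r / 2)) ?ge_min ?lexx//; lra.
have da : a <= x0 - d.
  rewrite lerBrDr -lerBrDl; rewrite /d !ge_min; apply/orP; right.
  by rewrite lexx.
have db : x0 + d <= b.
  rewrite -lerBrDl; rewrite /d !ge_min; apply/orP; right.
  by rewrite lexx orbT.
have cpn n : {in `[a, b], continuous (fun x => p x ^+ n : R)}.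
  by move=> x xab; cont_step; exact: cp.
have low n : q' ^+ n * (2 * d) <= sint a b (fun x => p x ^+ n).
  apply: (@le_trans _ _ (sint (x0 - d) (x0 + d) (fun x => p x ^+ n))).
    have -> : q' ^+ n * (2 * d) = sint (x0 - d) (x0 + d) (fun=> q' ^+ n).
      by rewrite sint_cst; [congr (_ * _); lra|lra].
    apply: le_sint.
    - by move=> x _; exact: cont_cst.
    - move=> x; rewrite in_itv /= => /andP[x1 x2]; apply: cpn.
      by rewrite in_itv /= (le_trans da x1) (le_trans x2 db).
    - move=> x /andP[x1 x2]; apply: lerXn2r; rewrite ?nnegrE ?ltW //.
        apply: lt_trans q'0 _; apply: rp.
        by rewrite /ball /= ltr_distl; apply/andP; split; lra.
      apply: rp.
      by rewrite /ball /= ltr_distl; apply/andP; split; lra.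
  by apply: sint_subset_le => // x xab; rewrite exprn_ge0 // p0.
have qq0 : 0 <= q / q' by rewrite divr_ge0 // ltW.
have : (q / q') ^+ n @[n --> \oo] --> (0 : R).
  apply: cvg_expr; rewrite ger0_norm //.
  by rewrite ltr_pdivrMr // mul1r.
move=> /cvgrPdist_lt /(_ (h * (2 * d))).
have hd : 0 < h * (2 * d) by rewrite !mulr_gt0.
move=> /(_ hd) [n _ /(_ n (leqnn n))]; rewrite sub0r normrN.
rewrite ger0_norm ?exprn_ge0 // expr_div_n.
rewrite ltr_pdivrMr ?exprn_gt0 // => qn.
exists n; split.
  by apply: lt_le_trans (low n); rewrite !mulr_gt0 // exprn_gt0.
move=> x xab xe; apply: (@le_trans _ _ (q ^+ n)).
  by apply: lerXn2r; rewrite ?nnegrE ?p0 //; exact: pq.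
rewrite (le_trans (ltW qn)) // -mulrA ler_pM2l // mulrC.
exact: low.
Qed.

(** The powers of [1 - (u - u x0)^2 / C] are polynomials in [u], and they
    concentrate at [x0] because [u] takes the value [u x0] only there.  The
    variable [y] is integrated outside, so [F] has to be controlled near [x0]
    uniformly in [y]. *)
Lemma moments_dint c d a b (x0 : R) (u : R -> R) (F : R -> R -> R) :
  c <= d -> a < x0 < b -> {in `[a, b], continuous u} -> jcont a b F ->
  (forall x, a <= x <= b -> u x = u x0 -> x = x0) ->
  (forall n, dint c d a b (fun y x => u x ^+ n * F y x) = 0) ->
  sint c d (F^~ x0) = 0.
Proof.
move=> cd /[dup] ax0b /andP[ax0 x0b] cu cF uinj mom.
have ab : a <= b by rewrite ltW // (lt_trans ax0).
have x0ab : a <= x0 <= b by rewrite !ltW.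
have cun n : {in `[a, b], continuous (fun x => u x ^+ n : R)}.
  by move=> x xab; cont_step; exact: cu.
have cpol (P : {poly R}) : {in `[a, b], continuous (fun x => P.[u x] : R)}.
  move=> x xab; apply: (@cont_comp _ _ _ x u (horner P)); first exact: cu.
  exact: continuous_horner.
have cPF (P : {poly R}) n : jcont a b (fun y x => P.[u x] * (u x ^+ n * F y x)).
  apply: jcontM; first exact: (@jcont_snd R).
  by apply: jcontM => //; exact: (@jcont_snd R).
have momP (P : {poly R}) n :
    dint c d a b (fun y x => P.[u x] * (u x ^+ n * F y x)) = 0.
  elim/poly_ind: P n => [|P k IHP] n.
    rewrite -[RHS](dint0 c d a b); apply: eq_dint => y x _ _.
    by rewrite horner0 mul0r.
  transitivity (dint c d a b (fun y x =>
      P.[u x] * (u x ^+ n.+1 * F y x) + k%:P.[u x] * (u x ^+ n * F y x))).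
    apply: eq_dint => y x _ _.
    by rewrite hornerD hornerM hornerX hornerC exprS; ring.
  rewrite dintD // IHP add0r.
  transitivity (dint c d a b (fun y x => k * (u x ^+ n * F y x))).
    by apply: eq_dint => y x _ _; rewrite hornerC.
  rewrite dintZ // ?mom ?mulr0 //.
  by apply: jcontM => //; exact: (@jcont_snd R).
have [C C0 uC] : exists2 C, 0 < C & forall x, a <= x <= b ->
    (u x - u x0) ^+ 2 <= C.
  pose g (x : R) : R := (u x - u x0) ^+ 2.
  have cd2 : {within `[a, b], continuous g}.
    apply: in_continuous_within => x xab.
    apply: (@contX R R x (fun x => u x - u x0) 2).
    by cont_step; [exact: cu|exact: cont_cst].
  have [w _ wmax] := EVT_max ab cd2.
  exists ((u w - u x0) ^+ 2 + 1); first by rewrite ltr_wpDl ?sqr_ge0.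
  by move=> x xab; rewrite (le_trans (wmax _ _)) ?in_itv // lerDl.
pose P : {poly R} := 1 - C^-1 *: ('X - (u x0)%:P) ^+ 2.
pose p x := P.[u x].
have pE x : p x = 1 - (u x - u x0) ^+ 2 / C.
  by rewrite /p /P hornerD hornerN hornerZ horner_exp hornerXsubC hornerC mulrC.
have p0 x : a <= x <= b -> 0 <= p x.
  by move=> /uC; rewrite pE subr_ge0 ler_pdivrMr // mul1r.
have px0 : p x0 = 1 by rewrite pE subrr expr0n mul0r subr0.
have p1 x : a <= x <= b -> x != x0 -> p x < 1.
  move=> xab xx0; rewrite pE gtrBl divr_gt0 // exprn_even_gt0 //= subr_eq0.
  by apply: contra xx0 => /eqP /(uinj _ xab) ->.
have cp : {in `[a, b], continuous p} by exact: cpol.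
have momp n : dint c d a b (fun y x => p x ^+ n * F y x) = 0.
  rewrite -[RHS](momP (P ^+ n) 0%N); apply: eq_dint => y x _ _.
  by rewrite expr0 mul1r horner_exp.
have cF0 : {in `[c, d], continuous (F^~ x0)}.
  move=> y _; have cp0 : {for y, continuous (fun y : R => (y, x0))}.
    by apply: cont_pair; [exact: cvg_id|exact: cvg_cst].
  exact: (cont_comp cp0 (cF y x0 x0ab)).
have unif e : 0 < e -> exists2 r, 0 < r & forall y x, c <= y <= d ->
    a <= x <= b -> `|x - x0| < r -> `|F y x - F y x0| < e.
  move=> e0; have := @segment_compact R c d.
  rewrite compact_near_coveringP => cov.
  have : \forall x \near x0, `[c, d]%classic `<=`
      (fun y => a <= x <= b -> `|F y x - F y x0| < e).
    apply: (cov R (nbhs x0)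
      (fun x y => a <= x <= b -> `|F y x - F y x0| < e)) => y _.
    have e20 : 0 < e / 2 by rewrite divr_gt0.
    have := cF y x0 x0ab => /cvgrPdist_lt /(_ _ e20) [[A B] /= [yA xB] AB].
    exists (A, B) => // -[y' x'] /= [Ay' Bx'] x'ab.
    rewrite (splitr e) -(subrKA (F y x0)) (le_lt_trans (ler_normD _ _)) //.
    rewrite ltrD //; first by rewrite distrC; exact: (AB (y', x')).
    by apply: (AB (y', x0)); split => //=; exact: nbhs_singleton.
  move=> /nbhs_ballP[r /= r0 rB]; exists r => // y x ycd xab xr.
  by apply: (rB x) => //=; rewrite /ball /= distrC.
have [M M0 FM] : exists2 M, 0 < M & forall y x, c <= y <= d -> a <= x <= b ->
    `|F y x - F y x0| <= M.
  have := @segment_compact R c d; rewrite compact_near_coveringP => cov.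
  have : \forall M \near +oo, `[c, d]%classic `<=`
      (fun y => forall x, a <= x <= b -> `|F y x - F y x0| <= M).
    apply: (cov R +oo
      (fun M y => forall x, a <= x <= b -> `|F y x - F y x0| <= M)) => y _.
    pose g (x : R) : R := `|F y x - F y x0|.
    have cFy : {within `[a, b], continuous g}.
      apply: in_continuous_within => x xab.
      apply: (@cont_comp _ _ _ x (fun x => F y x - F y x0) (@Num.norm _ R)).
        cont_step; [exact: (jcont_slice cF)|exact: cont_cst].
      exact: norm_continuous.
    have [w _ wmax] := EVT_max ab cFy.
    have := @jcont_near _ _ a b F y 1 cF ltr01 => nF.
    exists ([set y' | forall x, a <= x <= b -> `|F y' x - F y x| < 1],
      [set M | `|F y w - F y x0| + 2 <= M]) => /=.
      by split => //; exact: nbhs_pinfty_ge.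
    move=> -[y' M] /= [Fy' Mw] x xab; apply: le_trans Mw.
    have := wmax x; rewrite in_itv /= xab => /(_ isT) Fw.
    have := Fy' x xab; have := Fy' x0 x0ab => F1 F2.
    rewrite (_ : F y' x - F y' x0 = (F y x - F y x0) +
      ((F y' x - F y x) - (F y' x0 - F y x0))); last by ring.
    rewrite (le_trans (ler_normD _ _)) // lerD //.
    by rewrite (le_trans (ler_normB _ _)) //; lra.
  move=> /pinfty_ex_gt0 [M M0 HM]; exists M => // y x ycd xab.
  exact: HM.
apply/eqP; rewrite -normr_le0; apply/ler_addgt0Pr => e e0; rewrite add0r.
pose e' := e / (2 * (d - c + 1)).
have dc1 : 0 < 2 * (d - c + 1) by rewrite mulr_gt0 // ltr_wpDl // subr_ge0.
have e'0 : 0 < e' by rewrite divr_gt0.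
have [r r0 Fr] := unif _ e'0.
have h0 : 0 < e' / (M * (b - a)).
  by rewrite divr_gt0 // mulr_gt0 // subr_gt0 (lt_trans ax0).
have [n [In0 pn]] := peak_concentration ax0b r0 h0 cp p0 px0 p1.
set In := sint a b _ in In0 pn.
have cpn : {in `[a, b], continuous (fun x => p x ^+ n : R)}.
  by move=> x xab; cont_step; exact: cp.
have cpnF y : {in `[a, b], continuous (fun x => p x ^+ n * F y x : R)}.
  by move=> x xab; cont_step; [exact: cpn|exact: (jcont_slice cF)].
have ba0 : 0 < b - a by rewrite subr_gt0 (lt_trans ax0).
have bnd y : c <= y <= d ->
    `|sint a b (fun x => p x ^+ n * F y x) - In * F y x0| <= 2 * e' * In.
  move=> ycd.
  have -> : sint a b (fun x => p x ^+ n * F y x) - In * F y x0 =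
      sint a b (fun x => p x ^+ n * (F y x - F y x0)).
    rewrite mulrC -sintZ // -sintB //.
      by apply: eq_sint => x _; ring.
    by move=> x xab; cont_step; [exact: cont_cst|exact: cpn].
  rewrite /sint (le_trans (le_normr_Rintegral _ _)) //.
    apply: sint_integrable => x xab; cont_step; first exact: cpn.
    by cont_step; [exact: (jcont_slice cF)|exact: cont_cst].
  apply: (@le_trans _ _ (sint a b (fun x => e' * p x ^+ n + e' / (b - a) * In))).
    apply: le_sint.
    - move=> x xab.
      apply: (@cont_comp _ _ _ x (fun x => p x ^+ n * (F y x - F y x0))
        (@Num.norm _ R)); last exact: norm_continuous.
      cont_step; first exact: cpn.
      by cont_step; [exact: (jcont_slice cF)|exact: cont_cst].
    - move=> x xab; cont_step; last exact: cont_cst.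
      by cont_step; [exact: cont_cst|exact: cpn].
    move=> x xab; have pnx := exprn_ge0 n (p0 x xab).
    rewrite normrM (ger0_norm pnx).
    have t0 : 0 <= e' / (b - a) * In by rewrite mulr_ge0 ?divr_ge0 // ltW.
    have [xr|xr] := ltP `|x - x0| r.
      rewrite -[leLHS]addr0 lerD // mulrC ler_wpM2r // ltW //; exact: Fr.
    have ep0 : 0 <= e' * p x ^+ n by rewrite mulr_ge0 // ltW.
    rewrite -[leLHS]add0r lerD //.
    rewrite (le_trans (ler_pM _ _ (pn x xab xr) (FM y x ycd xab))) //.
    rewrite le_eqVlt; apply/orP; left; apply/eqP.
    by field; rewrite (gt_eqF M0) (gt_eqF ba0).
  rewrite sintD; last by move=> x _; exact: cont_cst.
    rewrite sintZ // sint_cst // -/In le_eqVlt; apply/orP; left; apply/eqP.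
    by field; rewrite (gt_eqF ba0).
  by move=> x xab; cont_step; [exact: cont_cst|exact: cpn].
have : `|dint c d a b (fun y x => p x ^+ n * F y x) - In * sint c d (F^~ x0)|
    <= 2 * e' * In * (d - c).
  have cj : jcont a b (fun y x => p x ^+ n * F y x).
    by apply: jcontM => //; exact: (@jcont_snd R).
  rewrite -sintZ // /dint -sintB.
  - apply: norm_sint_le => // y ycd.
    cont_step; first exact: (jcont_sint ab cj ycd).
    by cont_step; [exact: cont_cst|exact: cF0].
  - exact: jcont_sint.
  - by move=> y ycd; cont_step; [exact: cont_cst|exact: cF0].
rewrite momp sub0r normrN normrM (gtr0_norm In0).
rewrite [leRHS]mulrAC mulrC ler_pM2r // => /le_trans; apply.
have -> : e = 2 * e' * (d - c) + 2 * e'.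
  rewrite (_ : e = e' * (2 * (d - c + 1))); first by ring.
  by rewrite /e' divfK // gt_eqF.
by rewrite lerDl mulr_ge0 // ltW.
Qed.

Lemma moments_sint a b (x0 : R) (u f : R -> R) :
  a < x0 < b -> {in `[a, b], continuous u} -> {in `[a, b], continuous f} ->
  (forall x, a <= x <= b -> u x = u x0 -> x = x0) ->
  (forall n, sint a b (fun x => u x ^+ n * f x) = 0) ->
  f x0 = 0.
Proof.
move=> ax0b cu cf uinj mom.
have /= := @moments_dint 0 1 a b x0 u (fun _ => f) ler01 ax0b cu
  (@jcont_snd R R a b f cf) uinj.
rewrite sint_cst // subr0 mulr1; apply => n.
by rewrite /dint mom sint0.
Qed.

End moments.

(** * Functions of class C^k on three-space *)

Section smooth_functions.
Context {R : realType}.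
Implicit Types (f g : 'cV[R]_3 -> R) (x y v : 'cV[R]_3) (i : 'I_3) (k : nat).

Local Notation ee i := (delta_mx i 0 : 'cV[R]_3).

Lemma classC_continuous k f : classC k f -> continuous f.
Proof. by case: k => [|k] []. Qed.

Lemma classC_derivable k f x i : classC k.+1 f -> derivable f x (ee i).
Proof. by case=> _ /(_ i) []. Qed.

Lemma classC_partial k f i : classC k.+1 f -> classC k ('D_(ee i) f).
Proof. by case=> _ /(_ i) []. Qed.

Lemma classCW k f : classC k.+1 f -> classC k f.
Proof.
elim: k f => [|k IHk] f [cf df] //; split => // i; split=> [x|].
  by have [] := df i.
by apply: IHk; have [] := df i.
Qed.

Lemma classC_cst k (c : R) : classC k (fun=> c : R).
Proof.
elim: k c => [|k IHk] c; first by split => // x; exact: cont_cst.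
split=> [x|i]; first exact: cont_cst.
split=> [x|]; first exact: derivable_cst.
rewrite (_ : 'D__ _ = fun=> 0); first exact: IHk.
by apply/funext => x; rewrite derive_cst.
Qed.

Lemma classCD k f g : classC k f -> classC k g ->
  classC k (fun x => f x + g x).
Proof.
elim: k f g => [|k IHk] f g [cf df] [cg dg].
  by split => // x; exact: (contD (cf x) (cg x)).
split=> [x|i]; first exact: (contD (cf x) (cg x)).
have [[df1 df2] [dg1 dg2]] := (df i, dg i).
split=> [x|]; first exact: derivableD.
rewrite (_ : 'D__ _ = fun x => 'D_(ee i) f x + 'D_(ee i) g x).
  exact: IHk.
by apply/funext => x; exact: deriveD.
Qed.

Lemma classCM k f g : classC k f -> classC k g ->
  classC k (fun x => f x * g x).
Proof.
elim: k f g => [|k IHk] f g Cf Cg; have [[cf df] [cg dg]] := (Cf, Cg).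
  by split => // x; exact: (contM (cf x) (cg x)).
split=> [x|i]; first exact: (contM (cf x) (cg x)).
have [[df1 df2] [dg1 dg2]] := (df i, dg i).
split=> [x|]; first exact: derivableM.
rewrite (_ : 'D__ _ = fun x => f x * 'D_(ee i) g x + g x * 'D_(ee i) f x).
  by apply: classCD; apply: IHk => //; exact: classCW.
by apply/funext => x; exact: deriveM.
Qed.

Lemma classC_coord k i : classC k (fun x => x i 0 : R).
Proof.
case: k => [|k].
  by split => // x; exact: coord_continuous.
split=> [x|j]; first exact: coord_continuous.
have dE x : is_derive x (ee j) (fun x => x i 0 : R) ((ee j) i 0).
  apply: DeriveDef; first exact/diff_derivable/differentiable_coord.
  apply: cvg_lim => //.
  apply: cvg_trans (@cvg_cst _ ((ee j) i 0) _ (0 : R)^' _).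
  apply: near_eq_cvg; near=> h.
  have h0 : h != 0 by near: h; exact: nbhs_dnbhs_neq.
  have E : (h *: ee j + x) i 0 - x i 0 = h * (ee j) i 0.
    by rewrite mxE addrK mxE.
  by rewrite /= E /GRing.scale /= mulKf.
split=> [x|]; first by case: (dE x).
rewrite (_ : 'D__ _ = fun=> (ee j) i 0); first exact: classC_cst.
by apply/funext => x; case: (dE x).
Unshelve. all: by end_near. Qed.

Lemma classC_sum k n (F : 'I_n -> 'cV[R]_3 -> R) :
  (forall j, classC k (F j)) -> classC k (fun x => \sum_(j < n) F j x).
Proof.
elim: n F => [|n IHn] F CF.
  by under eq_fun do rewrite big_ord0; exact: classC_cst.
under eq_fun do rewrite big_ord_recr /=.
by apply: classCD => //; exact: IHn.
Qed.

Lemma ord3_ind (P : 'I_3 -> Prop) : P 0 -> P 1 -> P 2 -> forall i, P i.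
Proof.
move=> P0 P1 P2 [[|[|[|//]]] i3].
- by rewrite (_ : Ordinal _ = 0) //; exact: val_inj.
- by rewrite (_ : Ordinal _ = 1) //; exact: val_inj.
- by rewrite (_ : Ordinal _ = 2) //; exact: val_inj.
Qed.

Lemma sum3E (F : 'I_3 -> R) : \sum_(i < 3) F i = F 0 + F 1 + F 2.
Proof.
rewrite !big_ord_recl big_ord0 addr0 addrA.
by congr (_ + F _ + F _); exact: val_inj.
Qed.

(** The value of the differential, written with partial derivatives because only
    these are given by the class C^k. *)
Definition grad_dot f x v : R := \sum_(i < 3) v i 0 * 'D_(ee i) f x.

Lemma coordinate_mean_value f x i (t : R) : classC 1 f ->
  exists2 c, `|c| <= `|t| &
    f (t *: ee i + x) - f x = 'D_(ee i) f (c *: ee i + x) * t.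
Proof.
move=> Cf; pose g (s : R) := f (s *: ee i + x).
have dg (s : R) : is_derive s (1 : R) g ('D_(ee i) f (s *: ee i + x)).
  have E : (fun h : R => h^-1 *: ((g \o shift s) (h *: 1) - g s)) =
      (fun h : R => h^-1 *: ((f \o shift (s *: ee i + x)) (h *: ee i) -
        f (s *: ee i + x))).
    apply/funext => h /=; rewrite /g /=; congr (_ *: (f _ - _)).
    by rewrite scalerDl addrA [h *: 1]mulr1.
  apply: DeriveDef; rewrite /derivable /derive E //.
  have H := @classC_derivable 0 f (s *: ee i + x) i Cf; exact: H.
have cg a b : {within `[a, b], continuous g}.
  by apply: derivable_within_continuous => s _; case: (dg s).
have [t0|t0] := leP 0 t.
  have [c + gE] := MVT_segment t0 (fun s _ => dg s) (@cg 0 t).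
  rewrite in_itv /= => /andP[c0 ct]; exists c.
    by rewrite !ger0_norm.
  by move: gE; rewrite /g scale0r add0r subr0.
have [c + gE] := MVT_segment (ltW t0) (fun s _ => dg s) (@cg t 0).
rewrite in_itv /= => /andP[tc c0]; exists c.
  by rewrite !ler0_norm ?lerN2 // ltW.
move: gE; rewrite /g scale0r add0r sub0r => gE.
by apply/eqP; rewrite -eqr_opp opprB gE mulrN.
Qed.

(** Continuity of the intermediate points of [coordinate_mean_value]: they are
    only known through a bound on [c]. *)
Lemma cont_small_shift (c d : R -> R) (p : R -> 'cV[R]_3) i (s : R) :
  (forall t, `|c t| <= `|d t|) -> {for s, continuous d} -> d s = 0 ->
  {for s, continuous p} -> {for s, continuous (fun t => c t *: ee i + p t)}.
Proof.
move=> cd Cd ds0 Cp; apply: cvgD; last exact: Cp.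
have cs0 : c s = 0.
  by apply/eqP; rewrite -normr_le0 (le_trans (cd s)) // ds0 normr0.
suff Cc : {for s, continuous c} by exact: cvgZr_tmp.
apply/cvgrPdist_le => e e0; move: Cd => /cvgrPdist_le /(_ _ e0).
apply: filterS => t; rewrite cs0 ds0 !sub0r !normrN; exact: le_trans.
Qed.

(** Moving from [p s] to [p t] one coordinate at a time, each increment is a
    partial derivative at an intermediate point times a coordinate increment;
    the intermediate points tend to [p s] and the partial derivatives are
    continuous. *)
Lemma classC_chain_rule f (p : R -> 'cV[R]_3) (dp : 'cV[R]_3) (s : R) :
  classC 1 f -> (forall i, is_derive s (1 : R) (fun t => p t i 0) (dp i 0)) ->
  is_derive s (1 : R) (fun t => f (p t)) (grad_dot f (p s) dp).
Proof.
move=> Cf dpi.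
pose d i t := p t i 0 - p s i 0.
have Cd i : {for s, continuous (d i)}.
  have [di _] := dpi i; apply: contB; last exact: cont_cst.
  exact/differentiable_continuous/derivable1_diffP.
have ds0 i : d i s = 0 by rewrite /d subrr.
have shift i (q : R -> 'cV[R]_3) : {for s, continuous q} ->
    q s = p s ->
    exists G : R -> R, [/\ forall t,
      f (d i t *: ee i + q t) - f (q t) = G t * (t - s),
      {for s, continuous G} & G s = dp i 0 * 'D_(ee i) f (p s)].
  move=> Cq qs.
  have [G1 [G1E CG1 G1s]] := (is_derive1_caratheodory _ _ _).1 (dpi i).
  have /choice [c cE] : forall t, exists c, `|c| <= `|d i t| /\
     f (d i t *: ee i + q t) - f (q t) = 'D_(ee i) f (c *: ee i + q t) * d i t.
    move=> t; have [c c1 c2] := @coordinate_mean_value f (q t) i (d i t) Cf.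
    by exists c.
  exists (fun t => 'D_(ee i) f (c t *: ee i + q t) * G1 t); split.
  - by move=> t; have [_ ->] := cE t; rewrite -mulrA -G1E.
  - apply: contM => //.
    apply: (@cont_comp _ _ _ s (fun t => c t *: ee i + q t) ('D_(ee i) f)).
      by apply: (@cont_small_shift c (d i)) => // t; case: (cE t).
    exact: (classC_continuous (classC_partial i Cf)).
  - have [+ _] := cE s; rewrite ds0 normr0 normr_le0 => /eqP ->.
    by rewrite scale0r add0r qs G1s mulrC.
have Cps : {for s, continuous (fun _ : R => p s)} by exact: cvg_cst.
pose q1 t := d 0 t *: ee 0 + p s.
pose q2 t := d 1 t *: ee 1 + q1 t.
have Cq1 : {for s, continuous q1} by exact: (@cont_small_shift (d 0) (d 0)).
have Cq2 : {for s, continuous q2} by exact: (@cont_small_shift (d 1) (d 1)).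
have q1s : q1 s = p s by rewrite /q1 ds0 scale0r add0r.
have q2s : q2 s = p s by rewrite /q2 ds0 scale0r add0r.
have q3 t : d 2 t *: ee 2 + q2 t = p t.
  apply/matrixP => i j; rewrite ord1 /q2 /q1 /d !mxE; move: i.
  by apply: ord3_ind; rewrite /= ?(mulr1n, mulr0n) !(mulr0, mulr1) !add0r subrK.
have [G0 [G0E CG0 G0s]] := shift 0 _ Cps erefl.
have [G1 [G1E CG1 G1s]] := shift 1 _ Cq1 q1s.
have [G2 [G2E CG2 G2s]] := shift 2 _ Cq2 q2s.
apply/is_derive1_caratheodory.
exists (fun t => G0 t + G1 t + G2 t); split.
- move=> t; rewrite !mulrDl -G0E -G1E -G2E q3.
  by rewrite -/(q1 t) -/(q2 t); ring.
- by cont.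
- by rewrite G0s G1s G2s /grad_dot sum3E.
Qed.

End smooth_functions.

(** * Rotations and Euler angles *)

Section rotations.
Context {R : realType}.
Implicit Types (x y a b : 'cV[R]_3) (h k : 'M[R]_3).

Lemma colP3 x y : x 0 0 = y 0 0 -> x 1 0 = y 1 0 -> x 2 0 = y 2 0 -> x = y.
Proof.
by move=> e0 e1 e2; apply/matrixP => i j; rewrite ord1; move: i; exact: ord3_ind.
Qed.

Lemma vec3_0 (p q r : R) : vec3 p q r 0 0 = p. Proof. by rewrite mxE. Qed.
Lemma vec3_1 (p q r : R) : vec3 p q r 1 0 = q. Proof. by rewrite mxE. Qed.
Lemma vec3_2 (p q r : R) : vec3 p q r 2 0 = r. Proof. by rewrite mxE. Qed.
Definition vec3E := (vec3_0, vec3_1, vec3_2).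

Lemma mulmx3E h x i :
  (h *m x) i 0 = h i 0 * x 0 0 + h i 1 * x 1 0 + h i 2 * x 2 0.
Proof. by rewrite mxE sum3E. Qed.

Definition cross a b : 'cV[R]_3 :=
  vec3 (a 1 0 * b 2 0 - a 2 0 * b 1 0) (a 2 0 * b 0 0 - a 0 0 * b 2 0)
       (a 0 0 * b 1 0 - a 1 0 * b 0 0).

Lemma crossZr (c : R) a b : cross a (c *: b) = c *: cross a b.
Proof. by apply: colP3; rewrite ?(mxE, vec3E) /=; ring. Qed.

(** The special orthogonal group; preservation of the cross product replaces
    the condition on the determinant, being the form in which orientation
    enters below. *)
Definition rotation h :=
  h^T *m h = 1%:M /\ forall a b, h *m cross a b = cross (h *m a) (h *m b).

Lemma rotationM h k : rotation h -> rotation k -> rotation (h *m k).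
Proof.
move=> [hh hx] [kk kx]; split=> [|a b].
  by rewrite trmx_mul mulmxA -(mulmxA k^T) hh mulmx1.
by rewrite -!mulmxA kx hx.
Qed.

Lemma rotationT h : rotation h -> rotation h^T.
Proof.
move=> [hh hx]; have hh' := mulmx1C hh; split; first by rewrite trmxK.
move=> a b; rewrite -[a in LHS]mul1mx -[b in LHS]mul1mx -hh' -!mulmxA -hx.
by rewrite mulmxA hh mul1mx.
Qed.

Definition dot x y : R := x 0 0 * y 0 0 + x 1 0 * y 1 0 + x 2 0 * y 2 0.

Lemma dotE x y : dot x y = (x^T *m y) 0 0.
Proof. by rewrite mxE sum3E !mxE. Qed.

Lemma rotation_dot h x y : rotation h -> dot (h *m x) (h *m y) = dot x y.
Proof.
by move=> [hh _]; rewrite !dotE trmx_mul mulmxA -(mulmxA x^T) hh mulmx1.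
Qed.

Lemma enormE x : enorm x = Num.sqrt (dot x x).
Proof. by rewrite /enorm sum3E /dot !expr2. Qed.

Lemma rotU_mul (t : R) x : rotU t *m x =
  vec3 (cos t * x 0 0 - sin t * x 1 0) (sin t * x 0 0 + cos t * x 1 0) (x 2 0).
Proof. by apply: colP3; rewrite mulmx3E vec3E !mxE /=; ring. Qed.

Lemma rotV_mul (t : R) x : rotV t *m x =
  vec3 (cos t * x 0 0 + sin t * x 2 0) (x 1 0) (- sin t * x 0 0 + cos t * x 2 0).
Proof. by apply: colP3; rewrite mulmx3E vec3E !mxE /=; ring. Qed.

(** Applied to the basis vectors, whose images are the columns of [h]. *)
Lemma orthogonal_dot h : (forall x y, dot (h *m x) (h *m y) = dot x y) ->
  h^T *m h = 1%:M.
Proof.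
move=> hd; apply/matrixP => i j.
have -> : (h^T *m h) i j = dot (h *m delta_mx i 0) (h *m delta_mx j 0).
  by rewrite -!colE mxE sum3E /dot !mxE.
rewrite hd /dot !mxE !andbT.
by move: i j; do 2! apply: ord3_ind; rewrite /= ?(mulr1n, mulr0n);
  rewrite ?(mulr0, mulr1, addr0, add0r).
Qed.

Lemma rotation_rotU (t : R) : rotation (rotU t).
Proof.
have cs := cos2sin2 t; split=> [|a b].
  by apply: orthogonal_dot => x y; rewrite /dot !rotU_mul !vec3E; ring: cs.
by rewrite !rotU_mul; apply: colP3; rewrite !vec3E; ring: cs.
Qed.

Lemma rotation_rotV (t : R) : rotation (rotV t).
Proof.
have cs := cos2sin2 t; split=> [|a b].
  by apply: orthogonal_dot => x y; rewrite /dot !rotV_mul !vec3E; ring: cs.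
by rewrite !rotV_mul; apply: colP3; rewrite !vec3E; ring: cs.
Qed.

Lemma rotV0 : rotV 0 = 1%:M :> 'M[R]_3.
Proof.
apply/matrixP; apply: ord3_ind; apply: ord3_ind;
  by rewrite !mxE /= ?cos0 ?sin0 ?oppr0.
Qed.

Lemma sqr_le1_itv (p : R) : p ^+ 2 <= 1 -> -1 <= p <= 1.
Proof. by move=> p1; apply/andP; split; nra. Qed.

Lemma polar_angle (p q : R) : p ^+ 2 + q ^+ 2 = 1 ->
  exists2 t, 0 <= t <= 2 * pi & p = cos t /\ q = sin t.
Proof.
move=> pq; have p1 : -1 <= p <= 1 by apply: sqr_le1_itv; have := sqr_ge0 q; lra.
have p1' : p \in `[-1, 1] by rewrite in_itv.
have qE : Num.sqrt (1 - p ^+ 2) = `|q|.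
  by rewrite -pq addrAC subrr add0r sqrtr_sqr.
have t0 := acos_ge0 p1; have tpi := acos_lepi p1.
have pi0 := @pi_gt0 R.
have [q0|q0] := leP 0 q.
  exists (acos p); first by lra.
  by rewrite acosK // sin_acos // qE ger0_norm.
exists (2 * pi - acos p); first by lra.
have -> : 2 * pi - acos p = - acos p + pi *+ 2 by rewrite mulr2n; ring.
rewrite cosD2pi sinD2pi cosN sinN acosK // sin_acos // qE ler0_norm ?ltW //.
by rewrite opprK.
Qed.

Lemma spherical_angles x : dot x x = 1 ->
  exists t s : R, [/\ 0 <= t <= 2 * pi, 0 <= s <= pi &
    x = vec3 (sin s * cos t) (sin s * sin t) (cos s)].
Proof.
rewrite /dot => xx.
have z1 : -1 <= x 2 0 <= 1.
  by apply: sqr_le1_itv; have := sqr_ge0 (x 0 0); have := sqr_ge0 (x 1 0); nra.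
set s := acos (x 2 0).
have sx : cos s = x 2 0 by rewrite acosK // in_itv.
have s0pi : 0 <= s <= pi by rewrite acos_ge0 ?acos_lepi.
have ss : x 0 0 ^+ 2 + x 1 0 ^+ 2 = sin s ^+ 2 by rewrite sin2cos2 sx; lra.
have [s0|s0] := eqVneq (sin s) 0.
  have x0 : x 0 0 = 0 by move: ss; rewrite s0; nra.
  have x1 : x 1 0 = 0 by move: ss; rewrite s0; nra.
  exists 0, s; split => //; first by rewrite lexx mulr_ge0 ?pi_ge0.
  by apply: colP3; rewrite vec3E ?s0 ?mul0r ?x0 ?x1.
have [t t2pi [tc ts]] : exists2 t, 0 <= t <= 2 * pi &
    x 0 0 / sin s = cos t /\ x 1 0 / sin s = sin t.
  by apply: polar_angle; rewrite !expr_div_n -mulrDl ss divff // expf_neq0.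
exists t, s; split => //.
by apply: colP3; rewrite vec3E // -?tc -?ts mulrC divfK.
Qed.

(** Euler angles: once the image of the third axis is prescribed, only a
    rotation about that axis is left. *)
Lemma euler_angles h : rotation h -> exists t s g : R,
  [/\ 0 <= t <= 2 * pi, 0 <= s <= pi & h = rotU t *m rotV s *m rotU g].
Proof.
move=> rh; pose e1 : 'cV[R]_3 := vec3 1 0 0; pose e3 : 'cV[R]_3 := vec3 0 0 1.
have e33 : dot e3 e3 = 1 by rewrite /dot !vec3E; ring.
have e11 : dot e1 e1 = 1 by rewrite /dot !vec3E; ring.
have e13 : dot e1 e3 = 0 by rewrite /dot !vec3E; ring.
have [t [s [t2 s2 he3]]] : exists t s : R, [/\ 0 <= t <= 2 * pi,
    0 <= s <= pi & h *m e3 = vec3 (sin s * cos t) (sin s * sin t) (cos s)].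
  by apply: spherical_angles; rewrite rotation_dot.
pose k0 : 'M[R]_3 := rotU t *m rotV s.
have rk0 : rotation k0 by exact: rotationM (rotation_rotU _) (rotation_rotV _).
pose k := k0^T *m h.
have rk : rotation k by apply: rotationM => //; exact: rotationT.
have hE : h = k0 *m k.
  by rewrite /k mulmxA; case: rk0 => /mulmx1C -> _; rewrite mul1mx.
have ke3 : k *m e3 = e3.
  rewrite /k -mulmxA he3 -rot_e3 -/k0 mulmxA.
  by case: rk0 => -> _; rewrite mul1mx.
set u := k *m e1.
have u2 : u 2 0 = 0.
  have := rotation_dot e1 e3 rk; rewrite ke3 e13 -/u /dot !vec3E.
  by rewrite !mulr0 !add0r mulr1.
have [g _ [gc gs]] : exists2 g, 0 <= g <= 2 * pi & u 0 0 = cos g /\ u 1 0 = sin g.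
  apply: polar_angle; have := rotation_dot e1 e1 rk.
  by rewrite e11 -/u /dot u2 => <-; ring.
exists t, s, g; split => //; rewrite -/k0 hE; congr (_ *m _).
have ue : u = vec3 (cos g) (sin g) 0 by apply: colP3; rewrite vec3E.
have ke2 : k *m vec3 0 1 0 = vec3 (- sin g) (cos g) 0.
  have -> : vec3 0 1 0 = cross e3 e1.
    by apply: colP3; rewrite !vec3E; ring.
  case: rk => _ ->; rewrite ke3 -/u ue.
  by apply: colP3; rewrite !vec3E; ring.
have kx x : k *m x = rotU g *m x.
  have -> : x = x 0 0 *: e1 + (x 1 0 *: vec3 0 1 0 + x 2 0 *: e3).
    by apply: colP3; rewrite !mxE /=; ring.
  rewrite !mulmxDr -!scalemxAr ke3 ke2 -/u ue !rotU_mul.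
  by apply: colP3; rewrite !(mxE, vec3E) /=; ring.
apply/matrixP => i j.
by have := congr1 (fun v : 'cV[R]_3 => v i 0) (kx (delta_mx j 0)); rewrite /= -!colE !mxE.
Qed.

End rotations.

(** * Moments over apple surfaces *)

Section radial_ode.
Context {R : realType}.

(** The product of [y] by [r ^ (- k)] is constant, and it vanishes for small
    [r].  The power is written with [ln] as [k] may be negative. *)
Lemma homogeneous_ode_zero (k t1 d : R) (y y' : R -> R) :
  0 < t1 -> (forall r : R, is_derive r (1 : R) y (y' r)) ->
  (forall r : R, 0 < r < d -> r * y' r = k * y r) ->
  (forall r : R, 0 < r < t1 -> y r = 0) ->
  forall r : R, 0 < r < d -> y r = 0.
Proof.
move=> t10 dy ode y0 r /andP[r0 rd].
have [rt1|t1r] := ltP r t1; first by apply: y0; rewrite r0.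
pose s := t1 / 2.
have s0 : 0 < s by rewrite divr_gt0.
have st1 : s < t1 by rewrite /s; lra.
pose z x := y x * expR (- k * ln x).
have dz (x : R) : 0 < x -> is_derive x (1 : R) z
    ((y' x - k * y x / x) * expR (- k * ln x)).
  move=> x0; rewrite /z.
  der; [exact: dy|exact: is_derive1_ln|].
  by rewrite /=; ring.
have [||c _] := @MVT_segment R z (fun=> 0) s r (ltW (lt_le_trans st1 t1r)).
- move=> x; rewrite in_itv /= => /andP[sx xr].
  have x0 : 0 < x by apply: lt_trans sx.
  apply: (der_eq (dz x x0)).
  rewrite -ode ?x0 ?(lt_trans xr) // mulrAC divff ?gt_eqF // mul1r subrr.
  by rewrite mul0r.
- apply: derivable_within_continuous => x; rewrite in_itv /= => /andP[sx xr].
  have x0 : 0 < x by apply: lt_le_trans sx.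
  by case: (dz x x0).
rewrite mul0r {2}/z y0 ?s0 // mul0r subr0 /z => /eqP.
by rewrite mulf_eq0 (gt_eqF (expR_gt0 _)) orbF => /eqP.
Qed.

End radial_ode.

Lemma two_pi_ge0 {R : realType} : (0 : R) <= 2 * pi.
Proof. by rewrite mulr_ge0 // pi_ge0. Qed.

Lemma sin_gt0_segment {R : realType} (a b y : R) :
  0 < a -> b < pi -> a <= y <= b -> 0 < sin y.
Proof.
move=> a0 bpi /andP[ay yb].
by rewrite sin_gt0_pi // (lt_le_trans a0) // (le_lt_trans yb).
Qed.

Section moment_recursion.
Context {R : realType}.
Implicit Types (e et eth eph g : R -> R -> R -> R) (bt : R -> R).
Implicit Types (r t x y : R) (n : nat).

Definition cont3 g := continuous (fun q : R * R * R => g q.1.1 q.1.2 q.2 : R).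

Lemma cont3_comp {T : topologicalType} (p : T) g (A B C : T -> R) :
  cont3 g -> {for p, continuous A} -> {for p, continuous B} ->
  {for p, continuous C} ->
  {for p, continuous (fun q => g (A q) (B q) (C q) : R)}.
Proof.
move=> cg cA cB cC.
exact: (cont_comp (cont_pair (cont_pair cA cB) cC) (cg (A p, B p, C p))).
Qed.

(** The partial derivatives of [e (t, theta, phi)]; the last clause is the chain
    rule along the curves [phi |-> (r sin phi, theta, phi)] that generate the
    apple surfaces. *)
Definition polar_C1 e et eth eph : Prop :=
  [/\ cont3 e, cont3 et, cont3 eth & cont3 eph] /\
  [/\ forall t x y, is_derive t (1 : R) (fun t => e t x y) (et t x y),
      forall t x y, is_derive x (1 : R) (fun x => e t x y) (eth t x y) &
      forall r x y, is_derive y (1 : R) (fun y => e (r * sin y) x y)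
        (r * cos y * et (r * sin y) x y + eph (r * sin y) x y)].

Variables (a b : R).
Hypotheses (a_gt0 : 0 < a) (ab : a < b) (b_ltpi : b < pi).

Let leab : a <= b. Proof. exact: ltW. Qed.

Let sin_gt0 y : a <= y <= b -> 0 < sin y.
Proof. exact: sin_gt0_segment. Qed.

(** The area element [sin y ^+ 2] times a power of the cotangent.  Powers of the
    cotangent, not of the cosine, are the ones that the recursion reproduces. *)
Definition wt n y : R := sin y ^+ 2 * (cos y / sin y) ^+ n.

Definition mom n bt g r : R :=
  dint 0 (2 * pi) a b (fun x y => wt n y * (bt x * g (r * sin y) x y)).

Lemma wt_continuous n : {in `[a, b], continuous (wt n)}.
Proof.
move=> y; rewrite in_itv /= => yab; rewrite /wt; cont.
by rewrite gt_eqF // sin_gt0.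
Qed.

Lemma wt_derive n y : a <= y <= b -> is_derive y (1 : R) (wt n)
  ((2 - n%:R) * wt n.+1 y - n%:R * wt n.-1 y).
Proof.
move=> /sin_gt0 s0; have sn0 : sin y != 0 by rewrite gt_eqF.
rewrite /wt; der => //=; case: n => [|n] /=.
  by rewrite !expr0 expr1; field.
by rewrite !exprS; move: (_ ^+ n) n.+1%:R => P N; field.
Qed.

Lemma mom_jcont2 n bt g : continuous bt -> cont3 g -> jcont a b
  (fun (q : R * R) y => wt n y * (bt q.2 * g (q.1 * sin y) q.2 y)).
Proof.
move=> cbt cg; apply: jcontM; first exact: (@jcont_snd R (R * R)%type a b (wt n) (@wt_continuous n)).
move=> q y yab; cont_step.
  by apply: (@cont_comp _ _ _ _ (fun q : R * R * R => q.1.2) bt); [cont|exact: cbt].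
have cA : {for (q, y), continuous (fun q : R * R * R => q.1.1 * sin q.2 : R)}.
  by cont.
have cB : {for (q, y), continuous (fun q : R * R * R => q.1.2 : R)} by cont.
have cC : {for (q, y), continuous (fun q : R * R * R => q.2 : R)} by cont.
exact: (cont3_comp cg cA cB cC).
Qed.

Lemma mom_jcont n bt g r : continuous bt -> cont3 g ->
  jcont a b (fun x y => wt n y * (bt x * g (r * sin y) x y)).
Proof.
move=> cbt cg x y yab.
have cp : {for (x, y), continuous (fun p : R * R => (r, p.1, p.2))} by cont.
exact: (cont_comp cp (@mom_jcont2 n bt g cbt cg (r, x) y yab)).
Qed.

Lemma mom_derive n bt e et eth eph r : continuous bt ->
  polar_C1 e et eth eph ->
  is_derive r (1 : R) (mom n bt e)
    (mom n bt (fun t x y => sin y * et t x y) r).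
Proof.
move=> cbt [[ce cet _ _] [det _ _]].
pose st t x y := sin y * et t x y.
have cst : cont3 st.
  by move=> q; rewrite /st; cont_step; [cont|exact: cet].
have H s x y : a <= y <= b -> is_derive s (1 : R)
    (fun s => wt n y * (bt x * e (s * sin y) x y))
    (wt n y * (bt x * st (s * sin y) x y)).
  move=> _.
  have De : is_derive s (1 : R) (fun s => e (s * sin y) x y)
      (et (s * sin y) x y * sin y).
    have Ds : is_derive s (1 : R) (fun s => s * sin y : R) (sin y).
      by der; rewrite /=; ring.
    exact: (@der_comp _ s (fun t => e t x y) _ _ _ (det _ _ _) Ds).
  der; first exact: De.
  by rewrite /st /=; ring.
pose K g s x y := wt n y * (bt x * g (s * sin y) x y).
exact: (@dint_param_derive R 0 (2 * pi) a b (K e) (K st) r leab two_pi_ge0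
  (@mom_jcont2 n _ _ cbt ce) (@mom_jcont2 n _ _ cbt cst) H).
Qed.

(** Integration by parts along the meridians, on which the total derivative of
    [e (r sin y, x, y)] contains the term [r * cos y * et]; since [cos y] is
    [sin y] times the cotangent, that term raises the order of the moment by
    one. *)
Lemma mom_parts_phi n bt e et eth eph r : continuous bt ->
  polar_C1 e et eth eph ->
  (forall x, e (r * sin a) x a = 0) -> (forall x, e (r * sin b) x b = 0) ->
  r * mom n.+1 bt (fun t x y => sin y * et t x y) r =
  (n%:R - 2) * mom n.+1 bt e r + n%:R * mom n.-1 bt e r - mom n bt eph r.
Proof.
move=> cbt [[ce cet _ ceph] [_ _ dph]] ea eb.
pose M n g x y := wt n y * (bt x * g (r * sin y) x y).
pose st t x y := sin y * et t x y.
have cst : cont3 st.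
  by move=> q; rewrite /st; cont_step; [cont|exact: cet].
have cM m g : cont3 g -> jcont a b (M m g) by exact: mom_jcont.
have cZ (k : R) m g : cont3 g -> jcont a b (fun x y => k * M m g x y).
  by move=> cg; apply: jcontM; [exact: jcont_cst|exact: cM].
pose D x y := (2 - n%:R) * M n.+1 e x y + (- n%:R) * M n.-1 e x y +
  M n eph x y + r * M n.+1 st x y.
have c1 := cZ (2 - n%:R) n.+1 e ce.
have c2 := cZ (- n%:R) n.-1 e ce.
have c3 := cM n eph ceph.
have c4 := cZ r n.+1 st cst.
have c12 := jcontD c1 c2.
have c123 := jcontD c12 c3.
have cD : jcont a b D by exact: (jcontD c123 c4).
have : dint 0 (2 * pi) a b D = 0.
  rewrite -[RHS](sint0 0 (2 * pi)); apply: eq_sint => x _.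
  pose F y := wt n y * (bt x * e (r * sin y) x y).
  have DF y : a <= y <= b -> is_derive y (1 : R) F (D x y).
    move=> yab; rewrite /F; der; [exact: wt_derive|exact: dph|].
    have s0 : sin y != 0 by rewrite gt_eqF // sin_gt0.
    rewrite /D /M /st /wt /= [(_ / _) ^+ n.+1]exprS.
    move: ((_ / _) ^+ n) ((_ / _) ^+ n.-1) n%:R => P P' N.
    by move: (et _ _ _) (eph _ _ _) (e _ _ _) => v1 v2 v3; field.
  rewrite (sint_FTC2 ab DF (jcont_slice cD)).
  by rewrite /F ea eb !mulr0 subrr.
rewrite /D (dintD _ _ leab c123 c4) (dintD _ _ leab c12 c3).
rewrite (dintD _ _ leab c1 c2) !dintZ //; do ?exact: cM.
rewrite -/(mom n.+1 bt e r) -/(mom n.-1 bt e r) -/(mom n bt eph r).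
rewrite -/(mom n.+1 bt st r) => /eqP; rewrite addr_eq0 => /eqP E.
apply: oppr_inj; rewrite -E.
by move: (mom _ _ _ _) (mom _ _ _ _) (mom _ _ _ _) n%:R => m1 m2 m3 N; ring.
Qed.

(** Integration by parts along the circles of latitude; there is no boundary
    term by periodicity. *)
Lemma mom_parts_theta n bt bt' e et eth eph r : continuous bt' ->
  (forall x, is_derive x (1 : R) bt (bt' x)) -> bt (2 * pi) = bt 0 ->
  polar_C1 e et eth eph -> (forall t y, e t (2 * pi) y = e t 0 y) ->
  mom n bt eth r = - mom n bt' e r.
Proof.
move=> cbt' dbt bt2pi [[ce _ ceth _] [_ dth _]] e2pi.
have cbt : continuous bt by move=> x; exact: der_continuous (dbt x).
pose D x y := wt n y * (bt x * eth (r * sin y) x y) +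
  wt n y * (bt' x * e (r * sin y) x y).
have c1 := @mom_jcont n bt eth r cbt ceth.
have c2 := @mom_jcont n bt' e r cbt' ce.
have cD : jcont a b D := jcontD c1 c2.
have : dint 0 (2 * pi) a b D = 0.
  pose F x := sint a b (fun y => wt n y * (bt x * e (r * sin y) x y)).
  have pi2 : 0 < 2 * pi :> R by rewrite mulr_gt0 // pi_gt0.
  have DF x : 0 <= x <= 2 * pi -> is_derive x (1 : R) F (sint a b (D x)).
    move=> _; pose K x y := wt n y * (bt x * e (r * sin y) x y).
    have cK z : {in `[a, b], continuous (K z)}.
      exact: (jcont_slice (@mom_jcont n bt e r cbt ce)).
    have dK z y : a <= y <= b -> is_derive z (1 : R) (K^~ y) (D z y).
      move=> yab; rewrite /K; der; [exact: dbt|exact: dth|].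
      by rewrite /D /=; ring.
    exact: (@sint_param_derive R a b K D x cK cD dK).
  rewrite /dint (sint_FTC2 pi2 DF); last exact: jcont_sint.
  rewrite /F; apply/eqP; rewrite subr_eq0; apply/eqP.
  by apply: eq_sint => y _; rewrite bt2pi e2pi.
rewrite /D (dintD _ _ leab c1 c2).
by move=> /eqP; rewrite addr_eq0 => /eqP.
Qed.

End moment_recursion.

(** * Means over the equator *)

Lemma small_polar_angle {R : realType} (d t1 : R) : 0 < t1 ->
  exists a, [/\ 0 < a, a < pi / 2 & forall y, 0 <= y <= a -> d * sin y < t1].
Proof.
move=> t10.
have c0 : {for (0 : R), continuous (fun y => d * sin y : R)} by cont.
have : \forall y \near (0 : R), d * sin y < t1.
  by apply: (cvgr_lt _ c0); rewrite sin0 mulr0.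
move=> /nbhs_ballP[q /= q0 qb].
have pi0 := @pi_gt0 R.
pose a := Num.min (q / 2) (pi / 4).
have aq : a <= q / 2 by rewrite ge_min lexx.
have api : a <= pi / 4 by rewrite ge_min lexx orbT.
exists a; split; [by rewrite lt_min !divr_gt0|by lra|].
move=> y /andP[y0 ya]; apply: qb.
by rewrite /ball /= sub0r normrN ger0_norm //; lra.
Qed.

Section equatorial_means.
Context {R : realType}.
Implicit Types (e : R -> R -> R -> R) (r t x y : R) (n : nat).

Variables (G : (R -> R -> R -> R) -> Prop) (t1 d : R).
Hypothesis t1_gt0 : 0 < t1.
Hypothesis G_C1 : forall e, G e -> exists et eth eph,
  [/\ polar_C1 e et eth eph, forall t y, e t (2 * pi) y = e t 0 y,
      forall t x y, t < t1 -> e t x y = 0,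
      exists2 e1, G e1 & forall t x y, sin y * e1 t x y =
        sin y * cos x * eph t x y + cos y * (- sin x) * eth t x y &
      exists2 e2, G e2 & forall t x y, sin y * e2 t x y =
        sin y * sin x * eph t x y + cos y * cos x * eth t x y].
Hypothesis G_data : forall e r, G e -> 0 < r < d ->
  dint 0 (2 * pi) 0 pi (fun x y => sin y ^+ 2 * e (r * sin y) x y) = 0.

Let G_vanish e t x y : G e -> t < t1 -> e t x y = 0.
Proof. by move=> /G_C1 [et [eth [eph [_ _ e0 _ _]]]]; exact: e0. Qed.

Let G_cont e : G e -> cont3 e.
Proof. by move=> /G_C1 [et [eth [eph [[[]]]]]]. Qed.

Variable a : R.
Hypotheses (a_gt0 : 0 < a) (a_lt : a < pi / 2).
Hypothesis a_small : forall y, 0 <= y <= a -> d * sin y < t1.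

Let b := pi - a.
Let ab : a < b. Proof. by rewrite /b; have := a_lt; lra. Qed.
Let b_ltpi : b < pi. Proof. by rewrite /b gtrBl. Qed.
Let leab : a <= b. Proof. exact: ltW. Qed.

Let sin_gt0 y : a <= y <= b -> 0 < sin y.
Proof. exact: sin_gt0_segment. Qed.

(* Near the two poles the apple surface stays inside the ball where the
   functions vanish. *)
Let near_poles e r x y : G e -> 0 < r < d -> 0 <= y <= pi ->
  (y <= a) || (b <= y) -> e (r * sin y) x y = 0.
Proof.
move=> Ge /andP[r0 rd] /andP[y0 ypi] yab; apply: G_vanish => //.
have [z [za sz]] : exists z, 0 <= z <= a /\ sin z = sin y.
  case/orP: yab => [ya|yb]; first by exists y; rewrite y0.
  exists (pi - y); split; last first.
    by rewrite sinB sinpi cospi; ring.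
  by rewrite subr_ge0 ypi /= lerBlDr -lerBlDl.
have s0 : 0 <= sin y by rewrite sin_ge0_pi // y0.
apply: le_lt_trans (a_small za); rewrite sz.
by rewrite ler_wpM2r // ltW.
Qed.

Local Notation M n bt e r := (mom a b n bt e r).
Local Notation one := (fun=> 1 : R).

Let cont_one : continuous (one : R -> R).
Proof. by move=> x; exact: cvg_cst. Qed.

Let mom_one n e r : M n one e r =
  dint 0 (2 * pi) a b (fun x y => wt n y * e (r * sin y) x y).
Proof. by apply: eq_dint => x y _ _; rewrite mul1r. Qed.

Let data0 e r : G e -> 0 < r < d -> M 0 one e r = 0.
Proof.
move=> Ge r0d; rewrite mom_one -[RHS](G_data Ge r0d); apply: eq_sint => x _.
rewrite (@sint_restrict _ a b 0 pi); [|exact: ltW|exact: ltW|].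
  by apply: eq_sint => y _; rewrite /wt expr0 mulr1.
move=> y ypi yab; rewrite (@near_poles e) ?mulr0 //.
by move: yab; rewrite negb_and -!ltNge => /orP[|] /ltW ->; rewrite ?orbT.
Qed.

Let mom_small n bt e r : G e -> 0 < r < t1 -> M n bt e r = 0.
Proof.
move=> Ge /andP[r0 rt1]; rewrite -[RHS](dint0 0 (2 * pi) a b).
apply: eq_dint => x y _ _; rewrite G_vanish ?mulr0 //.
by rewrite (le_lt_trans _ rt1) // ger_pMr // sin_le1.
Qed.

Let parts_phi n (bt : R -> R) e et eth eph r : continuous bt -> G e ->
  polar_C1 e et eth eph -> 0 < r < d ->
  r * M n.+1 bt (fun t x y => sin y * et t x y) r =
  (n%:R - 2) * M n.+1 bt e r + n%:R * M n.-1 bt e r - M n bt eph r.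
Proof.
move=> cbt Ge C1 rd; apply: (mom_parts_phi a_gt0 ab b_ltpi n cbt C1).
- move=> x; apply: near_poles => //; last by rewrite lexx.
  by rewrite ltW // ltW // (lt_trans a_lt) // ltr_pdivrMr // ltr_pMr ?pi_gt0 // ltr1n.
- move=> x; apply: near_poles => //; last by rewrite lexx orbT.
  by rewrite !ltW // (lt_trans a_gt0).
Qed.

Let mom_ode n (bt : R -> R) e et eth eph k : continuous bt -> G e ->
  polar_C1 e et eth eph ->
  (forall r, 0 < r < d ->
    r * M n bt (fun t x y => sin y * et t x y) r = k * M n bt e r) ->
  forall r, 0 < r < d -> M n bt e r = 0.
Proof.
move=> cbt Ge C1 H.
apply: (@homogeneous_ode_zero _ k t1 d _
  (mom a b n bt (fun t x y => sin y * et t x y))) => //.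
- by move=> r; exact: (mom_derive a_gt0 ab b_ltpi n r cbt C1).
- by move=> r; exact: mom_small.
Qed.

Let jcont_mom n (bt : R -> R) e r : continuous bt -> cont3 e ->
  jcont a b (fun x y => wt n y * (bt x * e (r * sin y) x y)).
Proof. exact: (mom_jcont a_gt0 b_ltpi). Qed.

(** Odd moments against a first harmonic, from even moments of the first-order
    rotational derivative whose longitudinal part carries that harmonic. *)
Let odd_step (bt bt' : R -> R) n :
  continuous bt -> (forall x, is_derive x (1 : R) bt' (- bt x)) ->
  bt' (2 * pi) = bt' 0 ->
  (forall e, G e -> exists et eth eph e1,
    [/\ polar_C1 e et eth eph, forall t y, e t (2 * pi) y = e t 0 y, G e1 &
      forall t x y, sin y * e1 t x y =
        sin y * bt x * eph t x y + cos y * bt' x * eth t x y]) ->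
  (forall e r, G e -> 0 < r < d -> M n one e r = 0) ->
  (n = 0%N \/ forall e r, G e -> 0 < r < d -> M n.-1 bt e r = 0) ->
  forall e r, G e -> 0 < r < d -> M n.+1 bt e r = 0.
Proof.
move=> cbt dbt' bt'2pi HG Jn Pn e r Ge rd.
have [et [eth [eph [e1 [C1 e2pi Ge1 e1E]]]]] := HG _ Ge.
have cbt' : continuous bt' by move=> x; exact: der_continuous (dbt' x).
have [[ce cet ceth ceph] _] := C1.
apply: (mom_ode (k := n%:R - 1) cbt Ge C1) rd => {}r rd.
rewrite (parts_phi n cbt Ge C1 rd).
have -> : n%:R * M n.-1 bt e r = 0.
  by case: Pn => [->|Pn]; rewrite ?mul0r // Pn ?mulr0.
have cNbt : continuous (fun x => - bt x : R) by move=> x; apply: contN; exact: cbt.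
have := @mom_parts_theta R a b a_gt0 ab b_ltpi n.+1 bt' (fun x => - bt x)
  e et eth eph r cNbt dbt' bt'2pi C1 e2pi.
have -> : M n.+1 (fun x => - bt x) e r = - M n.+1 bt e r.
  rewrite -mulN1r -(dintZ _ _ _ leab (@jcont_mom n.+1 _ _ r cbt ce)).
  by apply: eq_dint => x y _ _; ring.
have : M n one e1 r = M n bt eph r + M n.+1 bt' eth r.
  rewrite -(dintD _ _ leab (@jcont_mom n _ _ r cbt ceph) (@jcont_mom n.+1 _ _ r cbt' ceth)).
  apply: eq_dint => x y _ yab; have s0 : sin y != 0 by rewrite gt_eqF // sin_gt0.
  rewrite mul1r (_ : e1 _ _ _ = bt x * eph (r * sin y) x y +
    cos y / sin y * (bt' x * eth (r * sin y) x y)).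
    by rewrite /wt [(_ / _) ^+ n.+1]exprS; move: ((_ / _) ^+ n) => P; ring.
  by apply: (mulfI s0); rewrite e1E; field.
rewrite (Jn _ _ Ge1 rd); move: (M n bt eph r) (M n.+1 bt' eth r) (M n.+1 bt e r) => u v w.
move=> /esym/eqP; rewrite addr_eq0 => /eqP -> ->; ring.
Qed.

(** Even moments, from odd moments of two rotational derivatives: combined with
    the weights [cos] and [sin] only the latitudinal derivative survives. *)
Let even_step n :
  (forall e r, G e -> 0 < r < d -> M n cos e r = 0) ->
  (forall e r, G e -> 0 < r < d -> M n sin e r = 0) ->
  (forall e r, G e -> 0 < r < d -> M n.-1 one e r = 0) ->
  forall e r, G e -> 0 < r < d -> M n.+1 one e r = 0.
Proof.
move=> Pn Qn Jn e r Ge rd.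
have [et [eth [eph [C1 _ _ [e1 Ge1 e1E] [e2 Ge2 e2E]]]]] := G_C1 Ge.
have [[ce cet ceth ceph] _] := C1.
apply: (mom_ode (k := n%:R - 2) cont_one Ge C1) rd => {}r rd.
rewrite (parts_phi n cont_one Ge C1 rd) Jn // mulr0 addr0.
suff -> : M n one eph r = M n cos e1 r + M n sin e2 r.
  by rewrite Pn // Qn // addr0 subr0.
have cos_e1 := @jcont_mom n _ _ r (@continuous_cos R) (G_cont Ge1).
have sin_e2 := @jcont_mom n _ _ r (@continuous_sin R) (G_cont Ge2).
rewrite -(dintD _ _ leab cos_e1 sin_e2).
apply: eq_dint => x y _ yab; have s0 : sin y != 0 by rewrite gt_eqF // sin_gt0.
rewrite -mulrDr; congr (_ * _); apply: (mulfI s0).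
have -> : sin y * (cos x * e1 (r * sin y) x y + sin x * e2 (r * sin y) x y) =
  cos x * (sin y * e1 (r * sin y) x y) + sin x * (sin y * e2 (r * sin y) x y).
  by ring.
rewrite e1E e2E; have cs := cos2sin2 x.
by ring: cs.
Qed.

Let all_moments j :
  [/\ forall e r, G e -> 0 < r < d -> M j.*2 one e r = 0,
      forall e r, G e -> 0 < r < d -> M j.*2.+1 cos e r = 0 &
      forall e r, G e -> 0 < r < d -> M j.*2.+1 sin e r = 0].
Proof.
have stepc n := @odd_step cos (fun x => - sin x) n.
have steps n := @odd_step sin cos n.
have odd n : (forall e r, G e -> 0 < r < d -> M n one e r = 0) ->
  (n = 0%N \/ (forall e r, G e -> 0 < r < d -> M n.-1 cos e r = 0) /\
              (forall e r, G e -> 0 < r < d -> M n.-1 sin e r = 0)) ->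
  (forall e r, G e -> 0 < r < d -> M n.+1 cos e r = 0) /\
  (forall e r, G e -> 0 < r < d -> M n.+1 sin e r = 0).
  move=> Jn Pn; split.
    apply: stepc => //.
    - exact: continuous_cos.
    - by rewrite mulrC -[2]/(2%:R) mulr_natr sin2pi sin0.
    - move=> e /G_C1 [et [eth [eph [C1 e2pi _ [e1 Ge1 e1E] _]]]].
      by exists et, eth, eph, e1.
    - by case: Pn => [->|[]]; [left|right].
  apply: steps => //.
  - exact: continuous_sin.
  - by rewrite mulrC -[2]/(2%:R) mulr_natr cos2pi cos0.
  - move=> e /G_C1 [et [eth [eph [C1 e2pi _ _ [e2 Ge2 e2E]]]]].
    by exists et, eth, eph, e2.
  - by case: Pn => [->|[]]; [left|right].
elim: j => [|j [J P Q]].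
  have [P Q] := odd 0%N data0 (or_introl erefl).
  exact: And3 data0 P Q.
have J' := even_step P Q J.
have [P' Q'] := odd _ J' (or_intror (conj P Q)).
exact: And3 J' P' Q'.
Qed.

(** Only even powers of the cotangent are available, so the moments lemma is
    applied to the square of the cotangent, which is injective at the equator
    and nowhere else. *)
Lemma equatorial_mean_aux e r : G e -> 0 < r < d ->
  sint 0 (2 * pi) (fun x => e r x (pi / 2)) = 0.
Proof.
move=> Ge rd; have ce := G_cont Ge.
pose u y : R := (cos y / sin y) ^+ 2.
pose F x y : R := wt 0 y * (1 * e (r * sin y) x y).
have pi0 := @pi_gt0 R.
have ahb : a < pi / 2 < b by rewrite /b; have := a_lt; lra.
have cu : {in `[a, b], continuous u}.
  move=> y; rewrite in_itv /= => yab; rewrite /u; cont.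
  by rewrite gt_eqF // sin_gt0.
have cF : jcont a b F by exact: (mom_jcont a_gt0 b_ltpi).
have uinj y : a <= y <= b -> u y = u (pi / 2) -> y = pi / 2.
  move=> yab; rewrite /u cos_pihalf mul0r expr0n /= => /eqP.
  rewrite expf_eq0 /= mulf_eq0 invr_eq0 (gt_eqF (sin_gt0 yab)) orbF => /eqP cy.
  have /andP[ay yb] := yab.
  apply: cos_inj; rewrite ?cos_pihalf // in_itv /=.
    rewrite (le_trans (ltW a_gt0) ay) (le_trans yb) //.
    by rewrite ltW.
  by lra.
have mom0 n : dint 0 (2 * pi) a b (fun x y => u y ^+ n * F x y) = 0.
  have [J _ _] := all_moments n; rewrite -[RHS](J _ _ Ge rd).
  apply: eq_dint => x y _ _; rewrite /F /u /wt -exprM expr0 -mul2n.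
  by ring.
rewrite -[RHS](moments_dint two_pi_ge0 ahb cu cF uinj mom0).
apply: eq_sint => x _.
by rewrite /F /wt sin_pihalf expr1n expr0 !(mul1r, mulr1).
Qed.

End equatorial_means.

(** [G] is a family of functions [e (t, theta, phi)] closed under the two
    first-order operators [e |-> e1], [e |-> e2] that the rotations about the
    horizontal axes induce at constant [t].  The vanishing of the surface
    integrals then propagates to all even moments in the cotangent, and these
    isolate the equator. *)
Theorem equatorial_mean_zero {R : realType} (G : (R -> R -> R -> R) -> Prop)
    (t1 d : R) : 0 < t1 ->
  (forall e, G e -> exists et eth eph,
  [/\ polar_C1 e et eth eph, forall t y, e t (2 * pi) y = e t 0 y,
      forall t x y, t < t1 -> e t x y = 0,
      exists2 e1, G e1 & forall t x y, sin y * e1 t x y =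
        sin y * cos x * eph t x y + cos y * (- sin x) * eth t x y &
      exists2 e2, G e2 & forall t x y, sin y * e2 t x y =
        sin y * sin x * eph t x y + cos y * cos x * eth t x y]) ->
  (forall e r, G e -> 0 < r < d ->
    dint 0 (2 * pi) 0 pi (fun x y => sin y ^+ 2 * e (r * sin y) x y) = 0) ->
  forall e r, G e -> 0 < r < d ->
    sint 0 (2 * pi) (fun x => e r x (pi / 2)) = 0.
Proof.
move=> t10 GC1 Gd e r Ge rd.
have [a [a0 ah asmall]] := small_polar_angle d t10.
exact: (equatorial_mean_aux t10 GC1 Gd a0 ah asmall Ge rd).
Qed.

(** * Rotational derivatives and apple coordinates *)

Section vector_valued.
Context {R : realType}.
Implicit Types (f : 'cV[R]_3 -> R) (x u v : 'cV[R]_3) (h : 'M[R]_3).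

Lemma cont_ext {T U : topologicalType} (t : T) (f1 f2 : T -> U) :
  (forall q, f1 q = f2 q) -> {for t, continuous f2} -> {for t, continuous f1}.
Proof. by move=> /funext ->. Qed.

Lemma cont_col {T : topologicalType} (t : T) (M : T -> 'cV[R]_3) :
  (forall i, {for t, continuous (fun q => M q i 0 : R)}) ->
  {for t, continuous M}.
Proof.
move=> cM.
have -> : M = fun q => M q 0 0 *: (delta_mx 0 0 : 'cV[R]_3) +
    (M q 1 0 *: delta_mx 1 0 + M q 2 0 *: delta_mx 2 0).
  apply/funext => q; apply: colP3; rewrite !mxE /=;
  by rewrite ?(mulr1n, mulr0n) !(mulr0, mulr1) ?addr0 ?add0r.
by apply: cvgD; [|apply: cvgD]; apply: cvgZr_tmp; exact: cM.
Qed.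

Lemma cont_vec3 {T : topologicalType} (t : T) (A B C : T -> R) :
  {for t, continuous A} -> {for t, continuous B} -> {for t, continuous C} ->
  {for t, continuous (fun q => vec3 (A q) (B q) (C q))}.
Proof.
move=> cA cB cC; apply: cont_col; apply: ord3_ind.
- exact: (cont_ext (fun q => vec3_0 (A q) (B q) (C q))).
- exact: (cont_ext (fun q => vec3_1 (A q) (B q) (C q))).
- exact: (cont_ext (fun q => vec3_2 (A q) (B q) (C q))).
Qed.

Lemma cont_coord {T : topologicalType} (t : T) (M : T -> 'cV[R]_3) i :
  {for t, continuous M} -> {for t, continuous (fun q => M q i 0 : R)}.
Proof. by move=> cM; exact: (cont_comp cM (@coord_continuous _ 3 1 i 0 (M t))). Qed.

Lemma cont_scale {T : topologicalType} (t : T) (c : T -> R) (M : T -> 'cV[R]_3) :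
  {for t, continuous c} -> {for t, continuous M} ->
  {for t, continuous (fun q => c q *: M q)}.
Proof. by move=> cc cM; apply: cvgZ. Qed.

Lemma cont_mulmx {T : topologicalType} (t : T) h (M : T -> 'cV[R]_3) :
  {for t, continuous M} -> {for t, continuous (fun q => h *m M q)}.
Proof.
move=> cM; apply: cont_col => i; apply: (cont_ext (fun q => mulmx3E h (M q) i)).
by cont; exact: cont_coord.
Qed.

Lemma cont_grad_dot {T : topologicalType} (t : T) f (p v : T -> 'cV[R]_3) :
  classC 1 f -> {for t, continuous p} -> {for t, continuous v} ->
  {for t, continuous (fun q => grad_dot f (p q) (v q) : R)}.
Proof.
move=> Cf cp cv; apply: (cont_ext (fun q => sum3E _)).
have cD i := cont_comp cp (@classC_continuous _ _ _ (classC_partial i Cf) (p t)).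
have cvi i := @cont_coord T t v i cv.
by apply: contD; [apply: contD|]; apply: contM; (exact: cD || exact: cvi).
Qed.

Lemma grad_dotD f x u v : grad_dot f x (u + v) = grad_dot f x u + grad_dot f x v.
Proof. by rewrite /grad_dot -big_split; apply: eq_bigr => i _; rewrite mxE mulrDl. Qed.

Lemma grad_dotZ f x (c : R) u : grad_dot f x (c *: u) = c * grad_dot f x u.
Proof.
by rewrite /grad_dot mulr_sumr; apply: eq_bigr => i _; rewrite mxE mulrA.
Qed.

(** The derivative of [f] along the rotations about the axis [a]. *)
Definition rot_deriv (a : 'cV[R]_3) f x : R := grad_dot f x (cross a x).

Lemma smooth_rot_deriv a f : smooth f -> smooth (rot_deriv a f).
Proof.
move=> Sf k; have Cf i := classC_partial i (Sf k.+1).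
apply: classC_sum => i; apply: classCM; last exact: Cf.
have Ccross (c d : R) j l : classC k (fun x : 'cV[R]_3 => c * x j 0 - d * x l 0).
  apply: classCD; first by apply: classCM; [exact: classC_cst|exact: classC_coord].
  have -> : (fun x : 'cV[R]_3 => - (d * x l 0)) = fun x => - d * x l 0.
    by apply/funext => x; rewrite mulNr.
  by apply: classCM; [exact: classC_cst|exact: classC_coord].
by move: i; apply: ord3_ind; rewrite /cross;
  [under eq_fun do rewrite vec3_0|under eq_fun do rewrite vec3_1|
   under eq_fun do rewrite vec3_2]; exact: Ccross.
Qed.

Lemma rot_deriv_vanish a f (O : set 'cV[R]_3) : open O ->
  (forall x, O x -> f x = 0) -> forall x, O x -> rot_deriv a f x = 0.
Proof.
move=> oO f0 x Ox; rewrite /rot_deriv /grad_dot big1 // => i _.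
rewrite (_ : 'D__ f x = 0) ?mulr0 //.
rewrite (@near_eq_derive _ _ _ _ (fun=> 0)); first exact: derive_cst.
near=> y; apply: f0; near: y; exact: open_nbhs_nbhs.
Unshelve. all: by end_near. Qed.

Lemma continuous_enorm : continuous (@enorm R).
Proof.
move=> x; rewrite /enorm.
apply: (@cont_comp _ _ _ x (fun x : 'cV[R]_3 => \sum_(i < 3) x i 0 ^+ 2)
  (@Num.sqrt R)); last exact: sqrt_continuous.
apply: (cont_ext (fun q => sum3E _)).
by cont; exact: coord_continuous.
Qed.

Lemma open_enorm_lt (c : R) : open [set x : 'cV[R]_3 | enorm x < c].
Proof.
rewrite (_ : [set x | _] = @enorm R @^-1` [set y | y < c]) //.
by apply: open_comp; [move=> x _; exact: continuous_enorm|exact: open_lt].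
Qed.

Lemma open_coord_lt (c : R) i : open [set x : 'cV[R]_3 | x i 0 < c].
Proof.
rewrite (_ : [set x | _] = (fun x : 'cV[R]_3 => x i 0 : R) @^-1` [set y | y < c]) //.
by apply: open_comp; [move=> x _; exact: coord_continuous|exact: open_lt].
Qed.

End vector_valued.

Section apple_coordinates.
Context {R : realType}.
Implicit Types (f : 'cV[R]_3 -> R) (h k : 'M[R]_3) (r t x y : R).

(** The radius at which a point sits on the apple surface when
    [t = r sin phi]; it is inverse to [rho |-> (rho - rho^-1) / 2]. *)
Definition rho t : R := Num.sqrt (t ^+ 2 + 1) + t.

Let sq_gt0 t : 0 < t ^+ 2 + 1.
Proof. by rewrite ltr_wpDl // sqr_ge0. Qed.

Let sqrt_gt0 t : 0 < Num.sqrt (t ^+ 2 + 1).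
Proof. by rewrite sqrtr_gt0. Qed.

Let sqr_sqrt t : Num.sqrt (t ^+ 2 + 1) ^+ 2 = t ^+ 2 + 1.
Proof. by rewrite sqr_sqrtr // ltW. Qed.

Lemma rho_gt0 t : 0 < rho t.
Proof.
rewrite /rho; have := sqrt_gt0 t; have := sqr_sqrt t.
set s := Num.sqrt _ => s2 s0; have [t0|t0] := leP 0 t; first by lra.
have st : 0 < s - t by lra.
rewrite -(pmulr_lgt0 _ st) (_ : _ * _ = s ^+ 2 - t ^+ 2); last by ring.
by rewrite s2; lra.
Qed.

Lemma rho_lt (c t : R) : 0 < c -> t < (c ^+ 2 - 1) / (2 * c) -> rho t < c.
Proof.
move=> c0; rewrite ltr_pdivlMr ?mulr_gt0 // => tc.
rewrite /rho; have := sqrt_gt0 t; have := sqr_sqrt t.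
set s := Num.sqrt _ => s2 s0; rewrite -ltrBrDr.
have ct : 0 < c - t by nra.
by rewrite -(ltr_pXn2r (n := 2)) ?nnegrE ?ltW // s2; nra.
Qed.

Lemma rhoK (c : R) : 0 < c -> rho ((c ^+ 2 - 1) / (2 * c)) = c.
Proof.
move=> c0; rewrite /rho; have cn0 : c != 0 by rewrite gt_eqF.
rewrite (_ : _ + 1 = ((c ^+ 2 + 1) / (2 * c)) ^+ 2); last by field.
rewrite sqrtr_sqr ger0_norm; first by field.
by rewrite divr_ge0 ?addr_ge0 ?sqr_ge0 // mulr_ge0 // ltW.
Qed.

Definition drho t : R := t / Num.sqrt (t ^+ 2 + 1) + 1.

Let sqrt_derive t : is_derive t (1 : R) (fun t : R => Num.sqrt (t ^+ 2 + 1))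
  (t / Num.sqrt (t ^+ 2 + 1)).
Proof.
have sn0 : Num.sqrt (t ^+ 2 + 1) != 0 by rewrite gt_eqF.
have D : is_derive t (1 : R) (fun t : R => t ^+ 2 + 1 : R) (2 * t).
  by der; rewrite /=; ring.
apply: (der_eq (@der_comp _ t Num.sqrt _ _ _ (is_derive1_sqrt (sq_gt0 t)) D)).
by field.
Qed.

Lemma rho_derive t : is_derive t (1 : R) rho (drho t).
Proof. by rewrite /rho; der; [exact: sqrt_derive|]. Qed.

(** The Jacobian [rho ^ 2 * rho'] of the change of radial variable. *)
Definition wgt t : R := rho t ^+ 2 * drho t.

Lemma drho_gt0 t : 0 < drho t.
Proof.
have sn0 : Num.sqrt (t ^+ 2 + 1) != 0 by rewrite gt_eqF.
rewrite /drho -[X in _ + X](divff sn0) -mulrDl divr_gt0 //.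
by rewrite addrC; exact: rho_gt0.
Qed.

Lemma wgt_gt0 t : 0 < wgt t.
Proof. by rewrite mulr_gt0 ?exprn_gt0 ?rho_gt0 ?drho_gt0. Qed.

Definition dwgt t : R := 2 * rho t * drho t ^+ 2 +
  rho t ^+ 2 * (1 / Num.sqrt (t ^+ 2 + 1) - t ^+ 2 / Num.sqrt (t ^+ 2 + 1) ^+ 3).

Lemma wgt_derive t : is_derive t (1 : R) wgt (dwgt t).
Proof.
have sn0 : Num.sqrt (t ^+ 2 + 1) != 0 by rewrite gt_eqF.
rewrite /wgt /drho; der; [exact: rho_derive| |exact: sqrt_derive|] => //.
rewrite /dwgt /drho /=; move: (rho t) => p.
by move: (Num.sqrt _) sn0 => s sn0; field.
Qed.

Lemma continuous_rho : continuous rho.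
Proof. by move=> t; exact: der_continuous (rho_derive t). Qed.

Lemma continuous_drho : continuous drho.
Proof.
move=> t; rewrite /drho; cont.
by rewrite gt_eqF.
Qed.

Lemma continuous_wgt : continuous wgt.
Proof. by move=> t; exact: der_continuous (wgt_derive t). Qed.

Lemma continuous_dwgt : continuous dwgt.
Proof.
move=> t; rewrite /dwgt; cont; do ?exact: continuous_rho;
  do ?exact: continuous_drho; by rewrite ?expf_neq0 // gt_eqF.
Qed.

Definition sph x y : 'cV[R]_3 := vec3 (sin y * cos x) (sin y * sin x) (cos y).
Definition sph_x x y : 'cV[R]_3 := vec3 (- (sin y * sin x)) (sin y * cos x) 0.
Definition sph_y x y : 'cV[R]_3 := vec3 (cos y * cos x) (cos y * sin x) (- sin y).

Lemma dot_sph x y : dot (sph x y) (sph x y) = 1.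
Proof.
rewrite /dot !vec3E; have cx := cos2sin2 x; have cy := cos2sin2 y.
by ring: cx cy.
Qed.

Lemma enorm_scale_sph h (c : R) x y : rotation h -> 0 <= c ->
  enorm (c *: (h *m sph x y)) = c.
Proof.
move=> rh c0; have dotZ (v : 'cV[R]_3) : dot (c *: v) (c *: v) = c ^+ 2 * dot v v.
  by rewrite /dot !mxE; ring.
by rewrite enormE dotZ rotation_dot // dot_sph mulr1 sqrtr_sqr ger0_norm.
Qed.

(** In the frame [h], the point of azimuth [x] and colatitude [y] on the apple
    surface of parameter [r] is [pt h (r * sin y) x y]. *)
Definition pt h t x y : 'cV[R]_3 := rho t *: (h *m sph x y).
Definition amp f h t x y : R := wgt t * f (pt h t x y).
Definition amp_t f h t x y : R := dwgt t * f (pt h t x y) +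
  wgt t * grad_dot f (pt h t x y) (drho t *: (h *m sph x y)).
Definition amp_x f h t x y : R :=
  wgt t * grad_dot f (pt h t x y) (rho t *: (h *m sph_x x y)).
Definition amp_y f h t x y : R :=
  wgt t * grad_dot f (pt h t x y) (rho t *: (h *m sph_y x y)).

Lemma cont_sph {T : topologicalType} (p : T) (A B : T -> R) :
  {for p, continuous A} -> {for p, continuous B} ->
  [/\ {for p, continuous (fun q => sph (A q) (B q))},
      {for p, continuous (fun q => sph_x (A q) (B q))} &
      {for p, continuous (fun q => sph_y (A q) (B q))}].
Proof.
by move=> cA cB; split; apply: cont_vec3; cont.
Qed.

Lemma amp_polar_C1 f h : smooth f ->
  polar_C1 (amp f h) (amp_t f h) (amp_x f h) (amp_y f h).
Proof.
move=> Sf; have C1 := Sf 1%N; have cf := classC_continuous (Sf 0%N).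
have cT (q : R * R * R) : {for q, continuous (fun q : R * R * R => q.1.1)} by cont.
have cX (q : R * R * R) : {for q, continuous (fun q : R * R * R => q.1.2)} by cont.
have cY (q : R * R * R) : {for q, continuous (fun q : R * R * R => q.2)} by cont.
have cg (g : R -> R) q : continuous g ->
    {for q, continuous (fun q : R * R * R => g q.1.1 : R)}.
  by move=> cg; exact: (cont_comp (cT q) (cg _)).
have cs q := cont_sph (cX q) (cY q).
have cr q := cg _ q continuous_rho.
have cpt q : {for q, continuous (fun q : R * R * R => pt h q.1.1 q.1.2 q.2)}.
  by have [c1 _ _] := cs q; exact: (@cont_scale _ _ _ (fun q : R * R * R => rho q.1.1) _ (cr q)
    (@cont_mulmx _ _ _ h _ c1)).
have cfpt q : {for q, continuous (fun q : R * R * R => f (pt h q.1.1 q.1.2 q.2) : R)}.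
  exact: (cont_comp (cpt q) (cf _)).
have cgr q (g : R -> R) (v : R * R * R -> 'cV[R]_3) : continuous g ->
    {for q, continuous v} -> {for q, continuous (fun q : R * R * R =>
      wgt q.1.1 * grad_dot f (pt h q.1.1 q.1.2 q.2) (g q.1.1 *: (h *m v q)) : R)}.
  move=> cg' cv.
  have cgv : {for q, continuous (fun q : R * R * R => g q.1.1 *: (h *m v q))}.
    exact: (@cont_scale _ _ _ (fun q : R * R * R => g q.1.1) _ (cg _ q cg')
      (@cont_mulmx _ _ _ h _ cv)).
  exact: (contM (cg _ q continuous_wgt) (cont_grad_dot C1 (cpt q) cgv)).
split; split.
- by move=> q; exact: (contM (cg _ q continuous_wgt) (cfpt q)).
- move=> q; have [c1 _ _] := cs q.
  have c2 := contM (cg _ q continuous_dwgt) (cfpt q).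
  exact: (contD c2 (cgr q drho _ continuous_drho c1)).
- by move=> q; have [_ c2 _] := cs q; exact: (cgr q rho _ continuous_rho c2).
- by move=> q; have [_ _ c3] := cs q; exact: (cgr q rho _ continuous_rho c3).
- move=> t x y; rewrite /amp.
  have D : is_derive t (1 : R) (fun t => f (pt h t x y))
      (grad_dot f (pt h t x y) (drho t *: (h *m sph x y))).
    apply: classC_chain_rule => // i; rewrite mxE /pt.
    under eq_fun do rewrite mxE.
    by der; [exact: rho_derive|rewrite /=; ring].
  der; [exact: wgt_derive|exact: D|].
  by rewrite /amp_t; ring.
- move=> t x y; rewrite /amp.
  have D : is_derive x (1 : R) (fun x => f (pt h t x y))
      (grad_dot f (pt h t x y) (rho t *: (h *m sph_x x y))).
    apply: classC_chain_rule => // i; rewrite mxE mulmx3E /pt /sph_x !vec3E.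
    under eq_fun do rewrite mxE mulmx3E /sph !vec3E.
    by der; rewrite /=; ring.
  by der; [exact: D|rewrite /amp_x; ring].
- move=> r x y; rewrite /amp.
  have Dt (g dg : R -> R) : (forall t, is_derive t (1 : R) g (dg t)) ->
      is_derive y (1 : R) (fun y => g (r * sin y)) (dg (r * sin y) * (r * cos y)).
    move=> Dg.
    have Ds : is_derive y (1 : R) (fun y => r * sin y : R) (r * cos y).
      by der; rewrite /=; ring.
    exact: (@der_comp _ y g _ _ _ (Dg _) Ds).
  have Dw := Dt wgt dwgt wgt_derive.
  have Dr := Dt rho drho rho_derive.
  have D : is_derive y (1 : R) (fun y => f (pt h (r * sin y) x y))
      (grad_dot f (pt h (r * sin y) x y)
        ((r * cos y) *: (drho (r * sin y) *: (h *m sph x y)) +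
         rho (r * sin y) *: (h *m sph_y x y))).
    apply: classC_chain_rule => // i.
    rewrite !mxE !sum3E /sph !vec3E /pt.
    under eq_fun do rewrite mxE mulmx3E /sph !vec3E.
    der; first exact: Dr.
    by rewrite /=; ring.
  der; [exact: Dw|exact: D|].
  by rewrite grad_dotD grad_dotZ /amp_t /amp_y /=; ring.
Qed.

End apple_coordinates.

(** * Functions with vanishing apple data *)

Section null_class.
Context {R : realType}.
Implicit Types (f : 'cV[R]_3 -> R) (h k : 'M[R]_3) (r t x y s : R).

Definition axis2 : 'cV[R]_3 := vec3 0 1 0.

(** The derivative in [r] of the apple interior integral of [f] in the frame
    [h], an integral over the apple surface of parameter [r]. *)
Definition surf f h r : R :=
  dint 0 (2 * pi) 0 pi (fun x y => sin y ^+ 2 * amp f h (r * sin y) x y).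

Definition null_class (c kap d : R) f :=
  [/\ smooth f, forall x : 'cV[R]_3, enorm x < c -> f x = 0,
      forall x : 'cV[R]_3, x 2 0 < kap -> f x = 0 &
      forall h r, rotation h -> 0 < r < d -> surf f h r = 0].

Lemma cont_rotV {T : topologicalType} (p : T) (S : T -> R) (M : T -> 'cV[R]_3) :
  {for p, continuous S} -> {for p, continuous M} ->
  {for p, continuous (fun q => rotV (S q) *m M q)}.
Proof.
move=> cS cM; apply: (cont_ext (fun q => rotV_mul (S q) (M q))).
have c0 := @cont_coord R T p M 0 cM; have c2 := @cont_coord R T p M 2 cM.
by apply: cont_vec3; [cont; assumption|exact: cont_coord|cont; assumption].
Qed.

Lemma conj_rotV_derive f k (c s : R) (v : 'cV[R]_3) : rotation k -> smooth f ->
  is_derive s (1 : R) (fun s => f (c *: (k *m (rotV s *m v))))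
    (rot_deriv (k *m axis2) f (c *: (k *m (rotV s *m v)))).
Proof.
move=> [_ kx] Sf; rewrite /rot_deriv crossZr -kx.
apply: classC_chain_rule; first exact: Sf 1%N.
move=> i; rewrite mxE mulmx3E.
under eq_fun do rewrite mxE mulmx3E !rotV_mul !vec3E.
rewrite /cross !rotV_mul /axis2 !vec3E.
by der; rewrite /=; ring.
Qed.

(** Rotating the frame by [s] about the axis [k *m axis2] leaves the surface
    integrals of [f] equal to zero, and their derivative in [s] is the surface
    integral of the rotational derivative. *)
Lemma null_rot_deriv (c kap d : R) k f : rotation k -> null_class c kap d f ->
  null_class c kap d (rot_deriv (k *m axis2) f).
Proof.
move=> rk [Sf fc fk fS]; split.
- exact: smooth_rot_deriv.
- exact: (@rot_deriv_vanish R (k *m axis2) f _ (@open_enorm_lt R c) fc).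
- exact: (@rot_deriv_vanish R (k *m axis2) f _ (@open_coord_lt R kap 2) fk).
- move=> h r rh rd; set g := rot_deriv _ f.
  pose hs s := k *m rotV s *m (k^T *m h).
  have rhs s : rotation (hs s).
    apply: rotationM; first exact: rotationM rk (rotation_rotV s).
    exact: rotationM (rotationT rk) rh.
  pose K (u : 'cV[R]_3 -> R) s x y := sin y ^+ 2 * amp u (hs s) (r * sin y) x y.
  have ptE s t x y : pt (hs s) t x y =
      rho t *: (k *m (rotV s *m (k^T *m h *m sph x y))).
    by rewrite /pt /hs -!mulmxA.
  have cK u : continuous u -> jcont 0 pi (fun q : R * R => K u q.1 q.2).
    move=> cu q y _.
    have cS : {for (q, y), continuous (fun p : R * R * R => p.1.1 : R)} by cont.
    have cX : {for (q, y), continuous (fun p : R * R * R => p.1.2 : R)} by cont.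
    have cY : {for (q, y), continuous (fun p : R * R * R => p.2 : R)} by cont.
    have cs : {for (q, y), continuous (fun p : R * R * R => sin p.2 : R)} by cont.
    have crs : {for (q, y), continuous (fun p : R * R * R => r * sin p.2 : R)}.
      by cont.
    have cw := cont_comp crs (@continuous_wgt R _).
    have cr := cont_comp crs (@continuous_rho R _).
    have [csph _ _] := cont_sph cX cY.
    have cV := cont_rotV cS (@cont_mulmx R _ _ (k^T *m h) _ csph).
    have cp := @cont_scale R _ _ _ _ cr (@cont_mulmx R _ _ k _ cV).
    have cup := cont_comp cp (cu _).
    apply: (cont_ext (f2 := fun p : R * R * R => sin p.2 ^+ 2 *
      (wgt (r * sin p.2) * u (rho (r * sin p.2) *: (k *m (rotV p.1.1 *m
        (k^T *m h *m sph p.1.2 p.2))))))).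
      by move=> p; rewrite /K /amp ptE.
    exact: (contM (@contX R _ _ _ 2 cs) (contM cw cup)).
  have cf := classC_continuous (Sf 0%N).
  have cg := classC_continuous (smooth_rot_deriv (k *m axis2) Sf 0%N).
  have dK s x y : 0 <= y <= pi ->
      is_derive s (1 : R) (fun s => K f s x y) (K g s x y).
    move=> _; rewrite /K /amp; under eq_fun do rewrite ptE; rewrite ptE.
    have D := conj_rotV_derive (rho (r * sin y)) s (k^T *m h *m sph x y) rk Sf.
    by der; [exact: D|rewrite /= -/g; ring].
  have [_ D0] := @dint_param_derive R 0 (2 * pi) 0 pi (K f) (K g) 0
    (pi_ge0 R) two_pi_ge0 (cK f cf) (cK g cg) dK.
  have h0 : hs 0 = h.
    by rewrite /hs rotV0 mulmx1 mulmxA; case: rk => /mulmx1C -> _; rewrite mul1mx.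
  transitivity (dint 0 (2 * pi) 0 pi (K g 0)).
    by apply: eq_dint => x y _ _; rewrite /K h0.
  rewrite -D0 (_ : (fun s => _) = fun=> 0) ?derive_cst //.
  by apply/funext => s; exact: fS (rhs s) rd.
Qed.

(** In the frame [k], the rotations about the images of the second axis and of
    the opposite of the first one induce the two operators required by
    [equatorial_mean_zero]; all axes [h *m axis2] are covered by
    [null_rot_deriv]. *)
Lemma great_circle_mean_zero (c kap d : R) f h r : 1 < c ->
  null_class c kap d f -> rotation h -> 0 < r < d ->
  sint 0 (2 * pi) (fun x => f (rho r *: (h *m vec3 (cos x) (sin x) 0))) = 0.
Proof.
move=> c1 Nf rh rd; have c0 : 0 < c by rewrite (lt_trans ltr01).
pose t1 := (c ^+ 2 - 1) / (2 * c).
have t10 : 0 < t1 by rewrite divr_gt0 ?mulr_gt0 // subr_gt0 expr_gt1 // ltW.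
pose G e := exists g k, [/\ null_class c kap d g, rotation k & e = amp g k].
have GC1 e : G e -> exists et eth eph,
  [/\ polar_C1 e et eth eph, forall t y, e t (2 * pi) y = e t 0 y,
      forall t x y, t < t1 -> e t x y = 0,
      exists2 e1, G e1 & forall t x y, sin y * e1 t x y =
        sin y * cos x * eph t x y + cos y * (- sin x) * eth t x y &
      exists2 e2, G e2 & forall t x y, sin y * e2 t x y =
        sin y * sin x * eph t x y + cos y * cos x * eth t x y].
  move=> [g [k [Ng rk ->]]]; have [Sg gc _ _] := Ng.
  exists (amp_t g k), (amp_x g k), (amp_y g k).
  have rotE (a : 'cV[R]_3) t x y (p q : R) :
      sin y *: cross a (sph x y) = p *: sph_y x y + q *: sph_x x y ->
      sin y * amp (rot_deriv (k *m a) g) k t x y =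
      p * amp_y g k t x y + q * amp_x g k t x y.
    move=> E; have [_ kx] := rk.
    rewrite /amp /rot_deriv [in cross _ _]/pt crossZr -kx /amp_y /amp_x.
    rewrite !grad_dotZ; set p0 := pt k t x y.
    have -> : sin y * (wgt t * (rho t * grad_dot g p0 (k *m cross a (sph x y)))) =
        wgt t * rho t * grad_dot g p0 (sin y *: (k *m cross a (sph x y))).
      by rewrite grad_dotZ; ring.
    rewrite scalemxAr E mulmxDr -!scalemxAr grad_dotD !grad_dotZ; ring.
  split.
  - exact: amp_polar_C1.
  - move=> t y; have pi2 : 2 * pi = pi *+ 2 :> R by rewrite mulr_natl.
    by rewrite /amp /pt /sph pi2 cos2pi sin2pi cos0 sin0.
  - move=> t x y tt1; rewrite /amp gc ?mulr0 // /pt enorm_scale_sph //.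
      exact: rho_lt.
    by rewrite ltW // rho_gt0.
  - exists (amp (rot_deriv (k *m axis2) g) k).
      exists (rot_deriv (k *m axis2) g), k.
      exact: And3 (null_rot_deriv rk Ng) rk erefl.
    move=> t x y; apply: rotE; rewrite /axis2 /cross.
    by apply: colP3; rewrite !(mxE, vec3E) /=; have cs := cos2sin2 x; ring: cs.
  - pose m := k *m rotU (pi / 2).
    have mE : m *m axis2 = k *m vec3 (-1) 0 0.
      rewrite /m -mulmxA rotU_mul; congr (_ *m _).
      by apply: colP3; rewrite !vec3E ?sin_pihalf ?cos_pihalf; ring.
    have rm : rotation m by apply: rotationM => //; exact: rotation_rotU.
    exists (amp (rot_deriv (m *m axis2) g) k).
      exists (rot_deriv (m *m axis2) g), k.
      exact: And3 (null_rot_deriv rm Ng) rk erefl.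
    move=> t x y; rewrite mE; apply: rotE; rewrite /cross.
    by apply: colP3; rewrite !(mxE, vec3E) /=; have cs := cos2sin2 x; ring: cs.
have Gd e s : G e -> 0 < s < d ->
    dint 0 (2 * pi) 0 pi (fun x y => sin y ^+ 2 * e (s * sin y) x y) = 0.
  by move=> [g [k [[_ _ _ gS] rk ->]]] sd; exact: gS.
have Ge : G (amp f h) by exists f, h.
have := equatorial_mean_zero t10 GC1 Gd Ge rd.
rewrite /amp /pt /sph sin_pihalf cos_pihalf.
have cf : continuous f by have [Sf _ _ _] := Nf; exact: classC_continuous (Sf 0%N).
rewrite sintZ.
  move=> /eqP; rewrite mulf_eq0 (gt_eqF (wgt_gt0 r)) /= => /eqP E.
  by rewrite -[RHS]E; apply: eq_sint => x _; rewrite !mul1r.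
move=> x _.
have cM : {for x, continuous (fun x : R =>
    rho r *: (h *m vec3 (1 * cos x) (1 * sin x) 0))}.
  apply: (@cont_scale R R x (fun=> rho r)); first exact: cont_cst.
  by apply: cont_mulmx; apply: cont_vec3; cont.
exact: (cont_comp cM (cf _)).
Qed.

End null_class.

(** * Great circles and the upper hemisphere *)

Section hemisphere.
Context {R : realType}.
Implicit Types (f : 'cV[R]_3 -> R) (al x y : R).

Definition rotX al : 'M[R]_3 :=
  mx3 [:: [:: 1; 0; 0]; [:: 0; cos al; - sin al]; [:: 0; sin al; cos al]].

Lemma rotX_mul al (v : 'cV[R]_3) : rotX al *m v =
  vec3 (v 0 0) (cos al * v 1 0 - sin al * v 2 0) (sin al * v 1 0 + cos al * v 2 0).
Proof. by apply: colP3; rewrite mulmx3E vec3E !mxE /=; ring. Qed.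

Lemma rotation_rotX al : rotation (rotX al).
Proof.
have cs := cos2sin2 al; split=> [|a b].
  by apply: orthogonal_dot => x y; rewrite /dot !rotX_mul !vec3E; ring: cs.
by rewrite !rotX_mul; apply: colP3; rewrite !vec3E; ring: cs.
Qed.

(** The great circle through the first axis, tilted by [al]. *)
Definition circ al x : 'cV[R]_3 := vec3 (cos x) (sin x * cos al) (sin x * sin al).
Definition circ_al al x : 'cV[R]_3 :=
  vec3 0 (- (sin x * sin al)) (sin x * cos al).

Lemma rotX_circle al x : rotX al *m vec3 (cos x) (sin x) 0 = circ al x.
Proof. by rewrite rotX_mul; apply: colP3; rewrite !vec3E; ring. Qed.

Lemma cross_circ al x :
  sin x *: cross (rotX al *m axis2) (circ al x) = - (cos x *: circ_al al x).
Proof.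
rewrite rotX_mul /axis2 /cross /circ /circ_al.
by apply: colP3; rewrite !(mxE, vec3E) /=; ring.
Qed.

Variables (c kap d r : R).
Hypotheses (c_gt1 : 1 < c) (kap_gt0 : 0 < kap) (rd : 0 < r < d).
Local Notation p := (rho r).

Let p0 : 0 < p. Proof. exact: rho_gt0. Qed.

Variable a : R.
Hypothesis a_gt0 : 0 < a.
Hypothesis a_small : forall y, 0 <= y <= a -> p * sin y < kap.

Let b := pi - a.

Let b_ltpi : b < pi. Proof. by rewrite /b gtrBl. Qed.

Let sin_gt0 y : a <= y <= b -> 0 < sin y.
Proof. exact: sin_gt0_segment. Qed.

Let small_sin y : 0 <= y <= pi -> (y <= a) || (b <= y) -> p * sin y < kap.
Proof.
move=> /andP[y0 ypi] /orP[ya|yb]; first by apply: a_small; rewrite y0.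
have -> : sin y = sin (pi - y) by rewrite sinB sinpi cospi; ring.
apply: a_small; rewrite subr_ge0 ypi /=.
by move: yb; rewrite /b; lra.
Qed.

Let circ_vanish f al x : null_class c kap d f -> 0 <= al <= pi ->
  0 <= x <= 2 * pi -> ~~ (a <= x <= b) -> f (p *: circ al x) = 0.
Proof.
move=> [_ _ fk _] alpi /andP[x0 x2pi] xab; apply: fk.
rewrite mxE vec3_2; have sa0 : 0 <= sin al by exact: sin_ge0_pi.
have sa1 := sin_le1 al.
have [sx0|sx0] := leP (sin x) 0.
  by rewrite (le_lt_trans _ kap_gt0) // pmulr_rle0 // mulr_le0_ge0.
have [xpi|xpi] := leP x pi; last first.
  move: sx0; rewrite (_ : x = (x - pi) + pi) ?sinDpi; last by ring.
  rewrite oppr_gt0 ltNge sin_ge0_pi //; lra.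
apply: (@le_lt_trans _ _ (p * sin x)).
  by rewrite ler_pM2l // ger_pMr.
apply: small_sin; first by rewrite x0.
by move: xab; rewrite negb_and -!ltNge => /orP[|] /ltW ->; rewrite ?orbT.
Qed.

Definition cot_moment n f al : R :=
  sint a b (fun x => (cos x / sin x) ^+ n * f (p *: circ al x)).

Let cont_circ (v : R -> R -> 'cV[R]_3) (q : R * R) (w : 'cV[R]_3 -> R) :
  {for q, continuous (fun q : R * R => v q.1 q.2)} -> continuous w ->
  {for q, continuous (fun q : R * R => w (p *: v q.1 q.2) : R)}.
Proof.
move=> cv cw.
have cpv := @cont_scale R _ q (fun=> p) _ (@cont_cst R _ q p) cv.
exact: (cont_comp cpv (cw _)).
Qed.

Let circ_cont (q : R * R) : {for q, continuous (fun q : R * R => circ q.1 q.2)}.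
Proof. by apply: cont_vec3; cont. Qed.

Let circ_al_cont (q : R * R) :
  {for q, continuous (fun q : R * R => circ_al q.1 q.2)}.
Proof. by apply: cont_vec3; cont. Qed.

Let cot_cont n : {in `[a, b], continuous (fun x => (cos x / sin x) ^+ n : R)}.
Proof.
by move=> x; rewrite in_itv /= => xab; cont; rewrite gt_eqF // sin_gt0.
Qed.

Let cot_jcont n (w : 'cV[R]_3 -> R) : continuous w ->
  jcont a b (fun al x => (cos x / sin x) ^+ n * w (p *: circ al x)).
Proof.
move=> cw; apply: (@jcontM R R a b (fun _ x => (cos x / sin x) ^+ n)).
  exact: (@jcont_snd R R a b _ (@cot_cont n)).
by move=> al x _; exact: (@cont_circ circ (al, x) w (@circ_cont _) cw).
Qed.

(** Tilting the circle moves its points along the rotation about the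
    horizontal line of its plane, up to a factor [- cot x]. *)
Let cot_moment_derive n f al : smooth f ->
  is_derive al (1 : R) (cot_moment n.+1 f)
    (- cot_moment n (rot_deriv (rotX al *m axis2) f) al).
Proof.
move=> Sf; have C1 := Sf 1%N; have cf := classC_continuous (Sf 0%N).
pose K al x : R := (cos x / sin x) ^+ n.+1 * f (p *: circ al x).
pose K' al x : R := (cos x / sin x) ^+ n.+1 *
  grad_dot f (p *: circ al x) (p *: circ_al al x).
have cK' : jcont a b K'.
  apply: (@jcontM R R a b (fun _ x => (cos x / sin x) ^+ n.+1)).
    exact: (@jcont_snd R R a b _ (@cot_cont n.+1)).
  move=> be x _.
  have c1 := @cont_scale R _ (be, x) (fun=> p) _ (@cont_cst R _ _ p)
    (@circ_cont (be, x)).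
  have c2 := @cont_scale R _ (be, x) (fun=> p) _ (@cont_cst R _ _ p)
    (@circ_al_cont (be, x)).
  exact: (cont_grad_dot C1 c1 c2).
have dK be x : a <= x <= b -> is_derive be (1 : R) (K^~ x) (K' be x).
  move=> _; rewrite /K.
  have D : is_derive be (1 : R) (fun be => f (p *: circ be x))
      (grad_dot f (p *: circ be x) (p *: circ_al be x)).
    apply: classC_chain_rule => // i; rewrite mxE.
    under eq_fun do rewrite mxE.
    move: i; apply: ord3_ind; rewrite /circ /circ_al !vec3E.
    - by under eq_fun do rewrite vec3_0; der; rewrite /=; ring.
    - by under eq_fun do rewrite vec3_1; der; rewrite /=; ring.
    - by under eq_fun do rewrite vec3_2; der; rewrite /=; ring.
  by der; [exact: D|rewrite /K' /=; ring].
have cK be : {in `[a, b], continuous (K be)}.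
  exact: (jcont_slice (@cot_jcont n.+1 f cf)).
apply: (der_eq (@sint_param_derive R a b K K' al cK cK' dK)).
set g := rot_deriv _ f.
have cg : continuous g := classC_continuous (smooth_rot_deriv _ Sf 0%N).
have cI := @jcont_slice R _ a b _ al (@cot_jcont n g cg).
rewrite -mulN1r /cot_moment -(sintZ _ cI).
apply: eq_sint => x xab; have s0 : sin x != 0 by rewrite gt_eqF // sin_gt0.
rewrite /K' /g /rot_deriv crossZr !grad_dotZ.
have -> : grad_dot f (p *: circ al x) (cross (rotX al *m axis2) (circ al x)) =
    - (cos x / sin x) * grad_dot f (p *: circ al x) (circ_al al x).
  apply: (mulfI s0); rewrite -grad_dotZ cross_circ -scaleNr grad_dotZ; field.
  exact: s0.
by rewrite exprS; ring.
Qed.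

(** At tilt zero the circle lies in the horizontal plane, where [f] vanishes;
    the derivative in the tilt is a lower moment of a rotational derivative,
    which is again in the class. *)
Let cot_moment_zero n f al : null_class c kap d f -> 0 <= al <= pi ->
  cot_moment n f al = 0.
Proof.
elim: n f al => [|n IHn] f al Nf alpi; have [Sf _ fk _] := Nf.
  have := great_circle_mean_zero c_gt1 Nf (rotation_rotX al) rd.
  rewrite (@sint_restrict _ a b) //.
  - move=> E; rewrite -[RHS]E; apply: eq_sint => x _.
    by rewrite expr0 mul1r rotX_circle.
  - exact: ltW.
  - by rewrite /b; have := a_gt0; have := @pi_gt0 R; lra.
  - by move=> x x2pi xab; rewrite rotX_circle circ_vanish.
have start : cot_moment n.+1 f 0 = 0.
  rewrite -[RHS](sint0 a b); apply: eq_sint => x _.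
  by rewrite fk ?mulr0 // mxE vec3_2 sin0 !mulr0.
have /andP[al0 alpi'] := alpi.
have [||be _] := @MVT_segment R (cot_moment n.+1 f) (fun=> 0) 0 al al0.
- move=> be; rewrite in_itv /= => /andP[be0 beal].
  apply: (der_eq (cot_moment_derive n be Sf)).
  rewrite (IHn _ _ (null_rot_deriv (rotation_rotX be) Nf)) ?oppr0 //.
  by rewrite (ltW be0) (le_trans (ltW beal)).
- apply: derivable_within_continuous => be _.
  by have [] := cot_moment_derive n be Sf.
by rewrite start subr0 mul0r.
Qed.

(** The cotangent is injective on the upper half circle, hence its moments
    determine [f] there. *)
Lemma circ_zero f al x : null_class c kap d f -> 0 <= al <= pi -> a < x < b ->
  f (p *: circ al x) = 0.
Proof.
move=> Nf alpi xab; have [Sf _ _ _] := Nf.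
have cf := classC_continuous (Sf 0%N).
apply: (@moments_sint R a b x (fun x => cos x / sin x)
  (fun x => f (p *: circ al x)) xab).
- move=> y yab; apply: (cont_ext _ (@cot_cont 1 y yab)) => z.
  by rewrite expr1.
- move=> y yab.
  have cy := @jcont_slice R _ a b _ al (@cot_jcont 0 f cf) y yab.
  by apply: (cont_ext _ cy) => z; rewrite expr0 mul1r.
- move=> y yab; have sy := sin_gt0 yab.
  have xab' : a <= x <= b by case/andP: xab => ? ?; rewrite !ltW.
  have sx := sin_gt0 xab'.
  have syn0 : sin y != 0 by rewrite gt_eqF.
  have sxn0 : sin x != 0 by rewrite gt_eqF.
  move=> /eqP; rewrite eqr_div // => /eqP E.
  have sB : sin (x - y) = 0 by rewrite sinB -E; ring.
  case/andP: yab => ay yb; case/andP: xab => ax xb.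
  have [xy|xy|-> //] := ltgtP x y.
    have : 0 < sin (y - x).
      by rewrite sin_gt0_pi // subr_gt0 xy /=; move: yb; rewrite /b; have := a_gt0; lra.
    by rewrite -(opprB x y) sinN sB oppr0 ltxx.
  have : 0 < sin (x - y).
    by rewrite sin_gt0_pi // subr_gt0 xy /=; move: xb; rewrite /b; have := a_gt0; lra.
  by rewrite sB ltxx.
- by move=> n; exact: cot_moment_zero.
Qed.

End hemisphere.

Lemma null_class_zero {R : realType} (c kap d r : R) (f : 'cV[R]_3 -> R) :
  1 < c -> 0 < kap -> 0 < r < d -> null_class c kap d f ->
  forall x, enorm x = rho r -> f x = 0.
Proof.
move=> c1 kap0 rd Nf x xr; have [_ _ fk _] := Nf.
have p0 := @rho_gt0 R r.
have [xk|xk] := ltP (x 2 0) kap; first exact: fk.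
have [a [a0 _ asmall]] := small_polar_angle (rho r) kap0.
pose y := (rho r)^-1 *: x.
have xE : x = rho r *: y by rewrite /y scalerA divff ?scale1r // gt_eqF.
pose v : 'cV[R]_3 := vec3 (y 1 0) (y 2 0) (y 0 0).
have v1 : dot v v = 1.
  have : enorm x ^+ 2 = rho r ^+ 2 by rewrite xr.
  rewrite enormE sqr_sqrtr; last by rewrite /dot -!expr2 !addr_ge0 ?sqr_ge0.
  rewrite xE /dot /v !vec3E ![(rho r *: y) _ 0]mxE => E.
  have pn0 : rho r ^+ 2 != 0 by rewrite expf_neq0 // gt_eqF.
  by apply: (mulfI pn0); rewrite -[in RHS]E; ring.
have [t [s [/andP[t0 t2] s01 vE]]] := spherical_angles v1.
have coordE i := congr1 (fun u : 'cV[R]_3 => u i 0) vE.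
have yE : y = circ t s.
  apply: colP3; rewrite /circ vec3E.
  - by have := coordE 2; rewrite /v !vec3E.
  - by have := coordE 0; rewrite /v !vec3E.
  - by have := coordE 1; rewrite /v !vec3E.
have ss0 : 0 <= sin s by exact: sin_ge0_pi.
have x2 : x 2 0 = rho r * (sin s * sin t) by rewrite xE yE mxE vec3_2.
have st0 : 0 < sin s * sin t.
  by rewrite -(pmulr_rgt0 _ p0) -x2 (lt_le_trans kap0).
have st : 0 < sin t.
  by move: st0; rewrite mulrC; have [//|h] := ltP 0 (sin t); nra.
have tpi : t <= pi.
  rewrite leNgt; apply/negP => tpi; move: st.
  rewrite (_ : t = (t - pi) + pi) ?sinDpi; last by ring.
  by rewrite oppr_gt0 ltNge sin_ge0_pi //; lra.
have big : kap <= rho r * sin s.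
  rewrite (le_trans xk) // x2 ler_pM2l // ger_pMr ?sin_le1 //.
  by rewrite lt_neqAle ss0 andbT eq_sym; apply: contraTneq st0 => ->; rewrite mul0r ltxx.
rewrite xE yE; apply: (circ_zero c1 kap0 rd a0 asmall Nf).
  by rewrite t0.
have /andP[s0 spi] := s01.
apply/andP; split; rewrite ltNge; apply/negP => h.
  by have := asmall s; rewrite s0 h => /(_ isT); rewrite ltNge big.
have := asmall (pi - s); rewrite subr_ge0 spi /= sinB sinpi cospi.
rewrite mul0r mulN1r sub0r opprK ltNge big /= => /(_ _).
by rewrite lerBlDr -lerBlDl h => /(_ isT).
Qed.

(** * Differentiating the apple interior transform *)

Section variable_endpoint.
Context {R : realType}.

Lemma mean_value_bound (F F' : R -> R) (u v B : R) :
  (forall s, is_derive s (1 : R) F (F' s)) ->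
  (forall s, `|s - u| <= `|v - u| -> `|F' s| <= B) ->
  `|F v - F u| <= B * `|v - u|.
Proof.
move=> dF F'B.
have cF (x y : R) : {within `[x, y], continuous F}.
  by apply: derivable_within_continuous => s _; case: (dF s).
have [uv|vu] := leP u v.
  have [s] := MVT_segment uv (fun s _ => dF s) (cF u v).
  rewrite in_itv /= => /andP[us sv] ->; rewrite normrM ler_wpM2r // F'B //.
  by rewrite !ger0_norm ?subr_ge0 // lerD2r.
have [s] := MVT_segment (ltW vu) (fun s _ => dF s) (cF v u).
rewrite in_itv /= => /andP[vs su] E.
rewrite -normrN opprB E normrM (distrC u v) ler_wpM2r // F'B //.
by rewrite !ler0_norm ?subr_le0 // ?(ltW vu) // lerN2 lerD2r.
Qed.

Context {T : topologicalType}.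
Variables (g : T -> R -> R) (eta : R).
Hypothesis cg : continuous (fun q : T * R => g q.1 q.2 : R).
Hypothesis eta_gt1 : 1 < eta.
Hypothesis g0 : forall p s, s < eta -> g p s = 0.

Let gjc (a b : R) : jcont a b g.
Proof. by move=> p x _; exact: cg. Qed.

Let gslice p : continuous (g p).
Proof.
move=> s; apply: (@jcont_slice R T s s g p (@gjc s s)).
by rewrite in_itv /= lexx.
Qed.

Let small_zero p u : u < eta -> sint 1 u (g p) = 0.
Proof.
move=> ue; rewrite -[RHS](sint0 1 u); apply: eq_sint => s /andP[_ su].
by rewrite g0 // (le_lt_trans su).
Qed.

(** Below [eta] the integral is locally zero, so only endpoints above 1 call for
    the fundamental theorem of calculus. *)
Lemma endpoint_derive p u :
  is_derive u (1 : R) (fun u => sint 1 u (g p)) (g p u).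
Proof.
have [ue|eu] := ltP u eta.
  have N0 : \forall s \near u, (fun=> 0 : R) s = sint 1 s (g p).
    near=> s; rewrite small_zero //; near: s.
    exact: lt_nbhsl.
  by rewrite g0 //; apply: near_eq_is_derive N0 _; exact: der_cst.
have u1 : 1 < u by exact: lt_le_trans eu.
have uu1 : u < u + 1 by rewrite ltrDl.
have ig : (@lebesgue_measure R).-integrable `[1, u + 1] (EFin \o g p).
  by apply: sint_integrable => s _; exact: gslice.
have [D E] := continuous_FTC1_closed uu1 ig u1 (@gslice p u).
by apply: DeriveDef; [exact: D|rewrite -derive1E; exact: E].
Unshelve. all: by end_near. Qed.

(** Continuity in the parameter at a fixed endpoint, combined with a Lipschitz
    bound in the endpoint that is uniform for nearby parameters. *)
Lemma endpoint_continuous :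
  continuous (fun q : T * R => sint 1 q.2 (g q.1) : R).
Proof.
move=> [p u]; apply/cvgrPdist_le => e e0 /=.
have e20 : 0 < e / 2 by rewrite divr_gt0.
have cp : {for p, continuous (fun p => sint 1 u (g p) : R)}.
  have [u1|u1] := leP 1 u; first by apply: sint_param_continuous.
  rewrite (_ : (fun p => _) = fun=> 0); first exact: cont_cst.
  by apply/funext => q; rewrite small_zero // (lt_trans u1).
have [B B0 gB] : exists2 B, 0 < B &
    forall s, u - 1 <= s <= u + 1 -> `|g p s| <= B.
  pose k (s : R) : R := `|g p s|.
  have ck : {within `[u - 1, u + 1], continuous k}.
    apply: in_continuous_within => s _.
    exact: (cont_comp (@gslice p s) (@norm_continuous _ _ _)).
  have le1 : u - 1 <= u + 1 by lra.
  have [w _ wmax] := EVT_max le1 ck.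
  exists (k w + 1); first by rewrite ltr_wpDl // normr_ge0.
  by move=> s ss; rewrite (le_trans (wmax _ _)) ?in_itv // lerDl.
have nB := @jcont_near R T (u - 1) (u + 1) g p 1 (@gjc _ _) ltr01.
move/cvgrPdist_le : cp => /(_ _ e20) np.
pose A := [set v : R | `|u - v| <= Num.min 1 (e / 2 / (B + 1))].
have nA : nbhs u A.
  have m0 : 0 < Num.min 1 (e / 2 / (B + 1)).
    by rewrite lt_min ltr01 !divr_gt0 // ltr_wpDl // ltW.
  apply/nbhs_ballP; exists (Num.min 1 (e / 2 / (B + 1))) => // v.
  by move=> /ltW.
pose P := [set q | (forall s, u - 1 <= s <= u + 1 -> `|g q s - g p s| < 1) /\
  `|sint 1 u (g p) - sint 1 u (g q)| <= e / 2].
exists (P, A) => /=; first by split => //; exact: filterI.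
move=> [q v] /= [[Pq1 Pq2] Av].
have {}Av : `|u - v| <= 1 /\ `|u - v| <= e / 2 / (B + 1).
  by move: Av; rewrite /A /= le_min => /andP[].
rewrite (splitr e) -(subrKA (sint 1 u (g q))) (le_trans (ler_normD _ _)) //.
rewrite lerD // distrC.
apply: (@le_trans _ _ ((B + 1) * `|v - u|)); last first.
  by rewrite distrC mulrC -ler_pdivlMr ?ltr_wpDl ?(ltW B0) //; case: Av.
apply: (@mean_value_bound (fun v => sint 1 v (g q)) (g q)).
  by move=> s; exact: endpoint_derive.
move=> s; rewrite (distrC v u) => /le_trans /(_ Av.1); rewrite ler_distl => sI.
rewrite -[g q s](subrK (g p s)) addrC (le_trans (ler_normD _ _)) // lerD ?gB //.
by rewrite ltW // Pq1.
Qed.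

End variable_endpoint.

Section apple_interior_derivative.
Context {R : realType}.
Implicit Types (f : 'cV[R]_3 -> R) (h k : 'M[R]_3) (r t x y s : R).

Let two_pi : 2 * pi = pi *+ 2 :> R. Proof. by rewrite mulr_natl. Qed.

Lemma surf_jcont f h r : smooth f ->
  jcont 0 pi (fun x y => sin y ^+ 2 * amp f h (r * sin y) x y).
Proof.
move=> Sf; have [[ca _ _ _] _] := amp_polar_C1 h Sf.
move=> x y _; have cs : {for (x, y), continuous (fun p : R * R => sin p.2 : R)} by cont.
have crs : {for (x, y), continuous (fun p : R * R => r * sin p.2 : R)} by cont.
exact: (contM (@contX R _ _ _ 2 cs)
  (cont3_comp ca crs (@cont_fst R R _) (@cont_snd R R _))).
Qed.

Lemma apple_interior_derive f (eta alpha beta r : R) : smooth f -> 1 < eta ->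
  (forall x : 'cV[R]_3, enorm x < eta -> f x = 0) ->
  is_derive r (1 : R) (fun r => apple_interior f r alpha beta)
    (surf f (rotU alpha *m rotV beta) r).
Proof.
move=> Sf eta1 feta; set h := rotU alpha *m rotV beta.
have rh : rotation h by exact: rotationM (rotation_rotU _) (rotation_rotV _).
have cf := classC_continuous (Sf 0%N).
(* The positive part of the radius makes the integrand vanish for all small
   radii, negative ones included. *)
pose pos (s : R) : R := (s + `|s|) / 2.
have posE s : 0 <= s -> pos s = s by move=> s0; rewrite /pos ger0_norm //; lra.
have pos_neg s : s < 0 -> pos s = 0.
  by move=> s0; rewrite /pos ler0_norm ?ltW //; lra.
pose g (q : R * R) s : R := s ^+ 2 * f (pos s *: (h *m sph q.1 q.2)).
have cg : continuous (fun q : (R * R) * R => g q.1 q.2 : R).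
  move=> q; have cs : {for q, continuous (fun q : (R * R) * R => q.2 : R)} by cont.
  have cp : {for q, continuous (fun q : (R * R) * R => pos q.2 : R)}.
    by rewrite /pos; cont.
  have c1 : {for q, continuous (fun q : (R * R) * R => q.1.1 : R)} by cont.
  have c2 : {for q, continuous (fun q : (R * R) * R => q.1.2 : R)} by cont.
  have [csph _ _] := cont_sph c1 c2.
  have cM := @cont_scale R _ _ _ _ cp (@cont_mulmx R _ _ h _ csph).
  exact: (contM (@contX R _ _ _ 2 cs) (cont_comp cM (cf _))).
have g0 (q : R * R) s : s < eta -> g q s = 0.
  move=> se; rewrite /g feta ?mulr0 //.
  have [s0|s0] := leP 0 s; first by rewrite posE // enorm_scale_sph.
  by rewrite pos_neg // enorm_scale_sph // (lt_trans ltr01).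
pose N x y u : R := sint 1 u (g (x, y)).
pose K r x y : R := sin y * N x y (rho (r * sin y)).
pose K' r x y : R := sin y ^+ 2 * amp f h (r * sin y) x y.
have [[ca _ _ _] _] := amp_polar_C1 h Sf.
have cK : jcont 0 pi (fun q : R * R => K q.1 q.2).
  move=> q y _.
  have cs : {for (q, y), continuous (fun p : R * R * R => sin p.2 : R)} by cont.
  have crs : {for (q, y), continuous (fun p : R * R * R => p.1.1 * sin p.2 : R)}.
    by cont.
  have cr := cont_comp crs (@continuous_rho R _).
  have cxy : {for (q, y), continuous (fun p : R * R * R => (p.1.2, p.2))} by cont.
  have cN := cont_comp (cont_pair cxy cr)
    (@endpoint_continuous R _ g eta cg eta1 g0 ((q.2, y), rho (q.1 * sin y))).
  exact: (contM cs cN).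
have cK' : jcont 0 pi (fun q : R * R => K' q.1 q.2).
  move=> q y _.
  have cs : {for (q, y), continuous (fun p : R * R * R => sin p.2 : R)} by cont.
  have crs : {for (q, y), continuous (fun p : R * R * R => p.1.1 * sin p.2 : R)}.
    by cont.
  have cx : {for (q, y), continuous (fun p : R * R * R => p.1.2 : R)} by cont.
  have cy : {for (q, y), continuous (fun p : R * R * R => p.2 : R)} by cont.
  exact: (contM (@contX R _ _ _ 2 cs) (cont3_comp ca crs cx cy)).
have dK s x y : 0 <= y <= pi -> is_derive s (1 : R) (fun s => K s x y) (K' s x y).
  move=> _; rewrite /K.
  have Ds : is_derive s (1 : R) (fun s => s * sin y : R) (sin y).
    by der; rewrite /=; ring.
  have Dr := @der_comp R s rho (fun s => s * sin y) _ _ (rho_derive _) Ds.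
  have DN := @der_comp R s (N x y) (fun s => rho (s * sin y)) _ _
    (endpoint_derive cg eta1 g0 (x, y) _) Dr.
  der; first exact: DN.
  rewrite /K' /amp /pt /wgt /g /= posE ?ltW ?rho_gt0 //; ring.
have D := @dint_param_derive R 0 (2 * pi) 0 pi K K' r (pi_ge0 R) two_pi_ge0 cK cK' dK.
have -> : (fun r => apple_interior f r alpha beta) =
    fun r => dint 0 (2 * pi) 0 pi (K r); last exact: D.
apply/funext => s; apply: eq_dint => x y _ _.
rewrite /K /N -sintZ; last first.
  move=> z _; have cp : {for z, continuous (fun z : R => ((x, y), z))}.
    by apply: cont_pair; [exact: cvg_cst|exact: cont_id].
  exact: (cont_comp cp (cg _)).
rewrite /rho exprMn /sint; apply: eq_Rintegral => z.
rewrite inE /= in_itv /= => /andP[z1 _].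
rewrite /g posE ?(le_trans ler01) // /polar_form /rot_act /= scalemxAr.
have -> : z *: sph x y =
    vec3 (z * sin y * cos x) (z * sin y * sin x) (z * cos y).
  by apply: colP3; rewrite mxE !vec3E; ring.
by rewrite -/h; ring.
Qed.

Lemma surfB f1 f2 h r : smooth f1 -> smooth f2 ->
  surf (fun x : 'cV[R]_3 => f1 x - f2 x) h r = surf f1 h r - surf f2 h r.
Proof.
move=> S1 S2; have c1 := @surf_jcont f1 h r S1; have c2 := @surf_jcont f2 h r S2.
have cN := jcontM (@jcont_cst R R 0 pi (-1)) c2.
rewrite /surf -mulN1r -(dintZ _ _ _ (pi_ge0 R) c2) -(dintD _ _ (pi_ge0 R) c1 cN).
by apply: eq_dint => x y _ _; rewrite /amp; ring.
Qed.

(** The derivative in [g] of the shifted integral is [H (2 * pi + g) - H g]. *)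
Lemma sint_periodic_shift (H H' : R -> R) (g : R) :
  (forall x, is_derive x (1 : R) H (H' x)) -> continuous H' ->
  (forall x, H (x + 2 * pi) = H x) ->
  sint 0 (2 * pi) (fun x => H (x + g)) = sint 0 (2 * pi) H.
Proof.
move=> dH cH' Hper; have pi2 : 0 < 2 * pi :> R by rewrite mulr_gt0 // pi_gt0.
have cH : continuous H by move=> x; exact: der_continuous (dH x).
pose F g := sint 0 (2 * pi) (fun x => H (x + g)).
have dshift g' x : is_derive g' (1 : R) (fun g => H (x + g)) (H' (x + g')).
  have Da : is_derive g' (1 : R) (fun g => x + g : R) 1 by der; ring.
  by apply: (der_eq (@der_comp R g' H _ _ _ (dH _) Da)); rewrite mulr1.
have dshift' g' x : is_derive x (1 : R) (fun x => H (x + g')) (H' (x + g')).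
  have Da : is_derive x (1 : R) (fun x => x + g' : R) 1 by der; ring.
  by apply: (der_eq (@der_comp R x H _ _ _ (dH _) Da)); rewrite mulr1.
have cshift (L : R -> R) g' x : continuous L ->
    {for x, continuous (fun x => L (x + g') : R)}.
  move=> cL; have ca : {for x, continuous (fun x : R => x + g' : R)} by cont.
  exact: (cont_comp ca (cL _)).
have dF g' : is_derive g' (1 : R) F 0.
  pose K g x : R := H (x + g); pose K' g x : R := H' (x + g).
  have cK g1 : {in `[0, 2 * pi], continuous (K g1)} by move=> x _; exact: cshift.
  have cK' : jcont 0 (2 * pi) K'.
    move=> g1 x _.
    have ca : {for (g1, x), continuous (fun p : R * R => p.2 + p.1 : R)} by cont.
    exact: (cont_comp ca (cH' _)).
  have D := @sint_param_derive R 0 (2 * pi) K K' g' cK cK'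
    (fun g1 x _ => dshift g1 x).
  apply: (der_eq D).
  rewrite (sint_FTC2 pi2 (fun x _ => dshift' g' x)).
    by rewrite add0r [2 * pi + _]addrC Hper subrr.
  by move=> x _; exact: cshift.
have := @is_derive_0_is_cst R F g 0 dF; rewrite /F => ->.
by apply: eq_sint => x _; rewrite addr0.
Qed.

(** A rotation of the frame about its own third axis only shifts the azimuth. *)
Lemma surf_rotU f h (g r : R) : smooth f ->
  surf f (h *m rotU g) r = surf f h r.
Proof.
move=> Sf; have [[ca cat cax _] [_ dx _]] := amp_polar_C1 h Sf.
pose L (u : R -> R -> R -> R) x y : R := sin y ^+ 2 * u (r * sin y) x y.
have cL u : cont3 u -> jcont 0 pi (L u).
  move=> cu x y _.
  have cs : {for (x, y), continuous (fun p : R * R => sin p.2 : R)} by cont.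
  have crs : {for (x, y), continuous (fun p : R * R => r * sin p.2 : R)} by cont.
  exact: (contM (@contX R _ _ _ 2 cs)
    (cont3_comp cu crs (@cont_fst R R _) (@cont_snd R R _))).
pose H x := sint 0 pi (L (amp f h) x).
pose H' x := sint 0 pi (L (amp_x f h) x).
have dH x : is_derive x (1 : R) H (H' x).
  have cK z : {in `[0, pi], continuous (L (amp f h) z)}.
    exact: (jcont_slice (cL _ ca)).
  have dK z y : 0 <= y <= pi ->
      is_derive z (1 : R) (fun z => L (amp f h) z y) (L (amp_x f h) z y).
    by move=> _; rewrite /L; der; [exact: dx|rewrite /=; ring].
  exact: (@sint_param_derive R 0 pi _ _ x cK (cL _ cax) dK).
have cH' : continuous H' by exact: (sint_param_continuous (pi_ge0 R) (cL _ cax)).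
have Hper x : H (x + 2 * pi) = H x.
  apply: eq_sint => y _; rewrite /L /amp /pt /sph two_pi.
  by rewrite sinD2pi cosD2pi.
rewrite -[RHS](sint_periodic_shift g dH cH' Hper).
apply: eq_sint => x _; apply: eq_sint => y _.
rewrite /L /amp /pt -mulmxA (_ : rotU g *m sph x y = sph (x + g) y) //.
by rewrite rotU_mul; apply: colP3; rewrite !vec3E ?sinD ?cosD; ring.
Qed.

End apple_interior_derivative.

(** * Uniqueness *)

Section apple_data.
Context {R : realType}.
Implicit Types (f : 'cV[R]_3 -> R).

(** The third coordinate is positive on the support, which is compact, hence
    bounded below there. *)
Lemma C0infty_vanish (eps1 eps2 : R) f :
  C0infty (hollow_ball eps1 eps2 `&` upper_half_space R) f ->
  exists2 kap, 0 < kap & forall x : 'cV[R]_3,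
    (enorm x <= eps1) || (x 2 0 < kap) -> f x = 0.
Proof.
move=> [_ cS sS].
have supp (x : 'cV[R]_3) : f x != 0 -> Defs.support f x.
  by move=> fx; exact: (@subset_closure _ [set y | f y != 0] x fx).
have [kap kap0 Hk] : exists2 kap : R, 0 < kap &
    forall x : 'cV[R]_3, x 2 0 < kap -> f x = 0.
  have [[z Sz]|S0] := pselect (Defs.support f !=set0); last first.
    exists 1 => // x _; apply/eqP; apply/negPn/negP => fx; apply: S0.
    by exists x; exact: supp.
  have cc : {within Defs.support f, continuous (fun x : 'cV[R]_3 => x 2 0 : R)}.
    by apply: continuous_subspaceT => x; exact: coord_continuous.
  have [w wS wmin] := @compact_EVT_min _ R (fun x : 'cV[R]_3 => x 2 0 : R)
    (Defs.support f) (ex_intro _ z Sz) cS cc.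
  rewrite inE in wS; have [_ /= w0] := sS _ wS.
  exists (w 2 0) => // x xw; apply/eqP; apply/negPn/negP => /supp Sx.
  by have := wmin x; rewrite inE => /(_ Sx); rewrite leNgt xw.
exists kap => // x /orP[x1|]; last exact: Hk.
apply/eqP; apply/negPn/negP => /supp /sS [/= /andP[]].
by rewrite ltNge x1.
Qed.

(** By Euler angles every frame is one of the data followed by a rotation about
    its third axis, which does not affect the surface integrals. *)
Lemma null_class_of_data (eta kap d : R) f1 f2 : 1 < eta ->
  smooth f1 -> smooth f2 ->
  (forall x : 'cV[R]_3, enorm x < eta -> f1 x = 0) ->
  (forall x : 'cV[R]_3, enorm x < eta -> f2 x = 0) ->
  (forall x : 'cV[R]_3, x 2 0 < kap -> f1 x = 0 /\ f2 x = 0) ->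
  (forall r alpha beta : R,
      0 <= r <= d -> 0 <= alpha <= 2 * pi -> 0 <= beta <= pi ->
      apple_interior f1 r alpha beta = apple_interior f2 r alpha beta) ->
  null_class eta kap d (fun x => f1 x - f2 x).
Proof.
move=> eta1 S1 S2 f1e f2e fk AI.
have S12 : smooth (fun x => f1 x - f2 x).
  move=> k; have -> : (fun x => f1 x - f2 x) = fun x => f1 x + -1 * f2 x.
    by apply/funext => x; rewrite mulN1r.
  by apply: classCD => //; apply: classCM => //; exact: classC_cst.
split=> //.
- by move=> x xe; rewrite f1e // f2e // subrr.
- by move=> x /fk [-> ->]; rewrite subrr.
move=> h r rh /andP[r0 rd].
have [t [s [g [t2 s2 ->]]]] := euler_angles rh.
rewrite surf_rotU // surfB //; apply/eqP; rewrite subr_eq0; apply/eqP.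
have [_ <-] := apple_interior_derive t s r S1 eta1 f1e.
have [_ <-] := apple_interior_derive t s r S2 eta1 f2e.
apply: near_eq_derive; near=> q; apply: AI => //.
by apply/andP; split; apply: ltW; near: q; [exact: lt_nbhsr|exact: lt_nbhsl].
Unshelve. all: by end_near. Qed.

End apple_data.

Theorem theorem6 (R : realType) (eps1 eps2 eps : R)
    (f1 f2 : 'cV[R]_3 -> R) :
  1 < eps1 -> eps1 < eps2 ->
  eps1 <= eps <= eps2 ->
  C0infty (hollow_ball eps1 eps2 `&` upper_half_space R) f1 ->
  C0infty (hollow_ball eps1 eps2 `&` upper_half_space R) f2 ->
  let delta := (eps ^+ 2 - 1) / (2 * eps) in
  (forall r alpha beta : R,
      0 <= r <= delta -> 0 <= alpha <= 2 * pi -> 0 <= beta <= pi ->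
      apple_interior f1 r alpha beta = apple_interior f2 r alpha beta) ->
  forall x : 'cV[R]_3, 1 <= enorm x <= eps -> f1 x = f2 x.
Proof.
move=> e1 e12 /andP[e1e ee2] C1 C2 delta AI x /andP[x1 xe].
have [k1 k10 V1] := C0infty_vanish C1; have [k2 k20 V2] := C0infty_vanish C2.
have [[S1 _ _] [S2 _ _]] := (C1, C2).
pose kap := Num.min k1 k2.
have kap0 : 0 < kap by rewrite lt_min k10.
pose f (y : 'cV[R]_3) := f1 y - f2 y.
have Nf : null_class eps1 kap delta f.
  apply: null_class_of_data => //.
  - by move=> y ye; rewrite V1 // ltW.
  - by move=> y ye; rewrite V2 // ltW.
  - move=> y; rewrite lt_min => /andP[yk1 yk2].
    by rewrite V1 ?V2 // ?yk1 ?yk2 orbT.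
have e0 : 0 < eps by rewrite (lt_le_trans _ e1e) // (lt_trans ltr01).
have inside (y : 'cV[R]_3) : eps1 < enorm y < eps -> f y = 0.
  move=> /andP[ye1 ye]; pose c := enorm y.
  have c1 : 1 < c by exact: lt_trans ye1.
  have c0 : 0 < c by exact: lt_trans c1.
  apply: (@null_class_zero R eps1 kap delta ((c ^+ 2 - 1) / (2 * c)) f) => //.
    rewrite divr_gt0 ?mulr_gt0 ?subr_gt0 ?expr_gt1 ?(ltW c0) //=.
    rewrite /delta ltr_pdivrMr ?mulr_gt0 // mulrAC ltr_pdivlMr ?mulr_gt0 //.
    have h : 0 < (eps - c) * (eps * c + 1).
      by rewrite mulr_gt0 ?subr_gt0 // addr_gt0 // mulr_gt0.
    by nra.
  by rewrite rhoK.
suff : f x = 0 by move=> /eqP; rewrite subr_eq0 => /eqP.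
have [xe1|xe1] := leP (enorm x) eps1.
  by rewrite /f V1 ?xe1 // V2 ?xe1 // subrr.
have [xlt|] := ltP (enorm x) eps; first by apply: inside; rewrite xe1.
move=> ex; have {xe ex}xE : enorm x = eps by apply/eqP; rewrite eq_le xe ex.
(* On the outer sphere the conclusion follows by continuity along the ray. *)
have cf : continuous f by have [Sf _ _ _] := Nf; exact: classC_continuous (Sf 0%N).
apply/eqP; apply/negPn/negP => fx.
have cray : {for (1 : R), continuous (fun s : R => f (s *: x) : R)}.
  have cs : {for (1 : R), continuous (fun s : R => s *: x)}.
    by apply: cvgZr_tmp; exact: cvg_id.
  exact: (cont_comp cs (cf _)).
have : \forall s \near (1 : R), f (s *: x) != 0.
  by apply: (cvgr_neq0 _ cray); rewrite scale1r.
move=> /nbhs_ballP[e /= ep0 eB].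
(* A factor close enough to 1 that still keeps the point beyond the inner
   sphere. *)
pose s := Num.max (1 - e / 2) ((1 + eps1 / eps) / 2).
have q1 : eps1 / eps < 1 by rewrite ltr_pdivrMr // mul1r -xE.
have s1 : s < 1 by rewrite gt_max; apply/andP; split; lra.
have sq : eps1 / eps < s by rewrite lt_max; apply/orP; right; lra.
have se : 1 - e / 2 <= s by rewrite le_max lexx.
have s0 : 0 <= s.
  by rewrite ltW // (lt_trans _ sq) // divr_gt0 // (lt_trans ltr01).
have /eqP : f (s *: x) != 0.
  by apply: eB; rewrite /ball /= ger0_norm ?subr_ge0 ?(ltW s1) //; lra.
apply; apply: inside.
have -> : enorm (s *: x) = s * eps.
  rewrite -xE !enormE (_ : dot (s *: x) (s *: x) = s ^+ 2 * dot x x).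
    by rewrite sqrtrM ?sqr_ge0 // sqrtr_sqr ger0_norm.
  by rewrite /dot !mxE; ring.
by rewrite -ltr_pdivrMr // sq /= gtr_pMl.
Qed.
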